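(* Let $(F_n,\phi_{n+1,n})_{n\ge 0}$ be a projective system of quantum graphs with compatible measures $\mu_n$. Let $(A_n,\mathrm{Dom}(A_n))$ be the associated operators on the $F_n$, whose pull-backs $(A_n,\mathcal{D}_n)$ to $\lim_{\leftarrow}F_i$ form an increasing family of self-adjoint operators. Let $\mathcal{D}'_n$ be the orthogonalized domains. (All of these are as defined in the context.) If $(A,\mathrm{Dom}(A))$ is the projective limit of the operators $(A_n,\mathrm{Dom}(A_n))$, then $$\sigma(A)=\bigcup_{n=0}^{\infty}\sigma\left(A_n|_{\mathcal{D}'_n}\right),$$ where multiplicities of the eigenvalues add, i.e. the multiplicity of $\lambda$ as an eigenvalue of $A$ is the sum over $n\ge 0$ of its multiplicities as an eigenvalue of $A_n|_{\mathcal{D}'_n}$.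
   Context: Quantum graphs. A metric graph consists of vertices and edges, each edge being identified with an interval of given length (multiple edges between two vertices are allowed, and every vertex lies on some edge); the distance between two points is the infimum of the lengths of paths joining them. A quantum graph is a metric graph equipped with a Hamiltonian (self-adjoint) operator. Projective system. A projective system $(F_n,\phi_{n+1,n})_{n\ge0}$ consists of topological spaces $F_n$ and continuous surjections $\phi_{n+1,n}:F_{n+1}\to F_n$. Its projective limit is $\lim_{\leftarrow}F_i=\{\{x_i\}\in\prod_i F_i : \phi_{i,i-1}(x_i)=x_{i-1}\text{ for all } i\ge1\}$, with the induced topology, and the coordinate maps $\Phi_n:\lim_{\leftarrow}F_i\to F_n$ are continuous surjections. Here each $F_n$ is a quantum graph carrying a measure $\mu_n$. The total masses of the $\mu_n$ are bounded, and $\int_{F_n}\mathbb{I}_B\,d\mu_n=\int_{F_{n+1}}\mathbb{I}_B\circ\phi_{n+1,n}\,d\mu_{n+1}$ for all $\mu_n$-measurable $B\subset F_n$. Consequently there is a limit measure $\mu=\mu_\infty$ on $\lim_{\leftarrow}F_i$ with $\int_{F_n}\mathbb{I}_B\,d\mu_n=\int \mathbb{I}_B\circ\Phi_n\,d\mu_\infty$. Put $\mathcal{H}=L^2(\lim_{\leftarrow}F_i,\mu)$. Operators. $A_n$ is the self-adjoint operator on $L^2(F_n,\mu_n)$ acting by $A_nf=-f''$ on each edge. Its domain $\mathrm{Dom}(A_n)$ consists of the (continuous) functions on $F_n$ that are twice differentiable on each edge (in the $L^2$/Sobolev sense) and such that at each vertex the one-sided first derivatives along the edges incident to the vertex sum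 to zero (Kirchhoff matching conditions; at a degree-one vertex this is the Neumann condition). Set $\mathcal{D}_n=\{f\circ\Phi_n : f\in\mathrm{Dom}(A_n)\}\subset\mathcal{H}$, and let $A_n$ act on $\mathcal{D}_n$ by $A_n(f\circ\Phi_n)=(A_nf)\circ\Phi_n$. The family is increasing: $\mathcal{D}_n\subset\mathcal{D}_{n+1}$, and $A_{n+1}g=A_ng$ for all $g\in\mathcal{D}_n$ and $n\ge0$. The projective limit of the operators $A_n$ is the minimal self-adjoint operator $(A,\mathrm{Dom}(A))$ on $\mathcal{H}$ extending all the $(A_n,\mathcal{D}_n)$. Its domain $\mathrm{Dom}(A)=\overline{\bigcup_{n\ge0}\mathcal{D}_n}$ is the closure in the graph norm $\|u\|=\|u\|_{L^2}+\|Au\|_{L^2}$. Orthogonalized domains. $\mathcal{D}'_0=\mathcal{D}_0$ and, for $n\ge1$, $\mathcal{D}'_n=\mathcal{D}_{n-1}^{\perp}\cap\mathcal{D}_n$, where $\perp$ is the orthogonal complement in $\mathcal{H}$; thus $\bigoplus_{n\ge0}\mathcal{D}'_n=\bigcup_{n\ge0}\mathcal{D}_n$ (algebraic direct sum). The spectrum $\sigma(A_n|_{\mathcal{D}'_n})$ is that of the restriction of $A_n$ to $\mathcal{D}'_n$, regarded as an operator on the closure of $\mathcal{D}'_n$ in $\mathcal{H}$.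
   Formalization: The union of the spectra is replaced by its closure, since the printed equality fails when the union is not closed (e.g. circles R/2^nZ, whose limit is a solenoid); when the union is closed the printed equality follows. The multiplicity claim is unchanged. *)

(* Defs.v *)
From HB Require Import structures.
From mathcomp Require Import all_boot all_order all_algebra.
From mathcomp Require Import complex.
From mathcomp Require Import all_classical all_reals all_analysis.
Set Implicit Arguments.
Unset Strict Implicit.
Unset Printing Implicit Defensive.
Import Order.TTheory GRing.Theory Num.Theory numFieldNormedType.Exports.
Local Open Scope classical_set_scope.
Local Open Scope ring_scope.
Local Open Scope complex_scope.

(* The usual topology of the complex plane: the library only puts it on the
   alias R[i]^o, as on every numFieldType. *)
HB.instance Definition _ (R : rcfType) := PseudoMetric.copy R[i] R[i]^o.

(** * Complex L^2 spaces and unbounded operators *)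

(* An element of L^2(mu) is represented by a function, and equality in L^2(mu)
   is equality mu-almost everywhere. Every set of functions or of pairs of
   functions below that stands for a subset of L^2(mu) or of its square is
   saturated for this equality. *)

Section L2.
Context {R : realType} {d : measure_display} {T : measurableType d}.
Variable mu : {measure set T -> \bar R}.
Implicit Types (f g u v w : T -> R[i]) (D : set T).

Definition cintegral D f : R[i] :=
  (\int[mu]_(x in D) complex.Re (f x)) +i* (\int[mu]_(x in D) complex.Im (f x)).

Definition sq_integrable D f : Prop :=
  [/\ measurable_fun D (fun x => complex.Re (f x)),
      measurable_fun D (fun x => complex.Im (f x)) &
      (\int[mu]_(x in D)
         (complex.Re (f x) ^+ 2 + complex.Im (f x) ^+ 2)%:E < +oo)%E].

Definition L2 : set (T -> R[i]) := [set f | sq_integrable setT f].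

Definition L2dot f g : R[i] := cintegral setT (fun x => f x * (g x)^*).

Definition L2norm f : R := Num.sqrt (complex.Re (L2dot f f)).

Definition orthocompl (S : set (T -> R[i])) : set (T -> R[i]) :=
  [set f | L2 f /\ forall g, S g -> L2dot f g = 0].

Definition L2closure (S : set (T -> R[i])) : set (T -> R[i]) :=
  [set f | L2 f /\
    forall e : R, 0 < e -> exists2 g, S g & L2norm (fun x => f x - g x) < e].

(* An operator is given by its graph. *)
Definition opgraph := set ((T -> R[i]) * (T -> R[i])).
Implicit Types (A B : opgraph).

Definition dom A : set (T -> R[i]) := [set u | exists v, A (u, v)].

Definition restrict A (S : set (T -> R[i])) : opgraph :=
  [set uv | A uv /\ S uv.1].

Definition is_linear_operator A : Prop :=
  [/\ forall u v, A (u, v) -> L2 u /\ L2 v,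
      forall u v u' v', A (u, v) -> L2 u' -> L2 v' ->
        u = u' %[ae mu] -> v = v' %[ae mu] -> A (u', v'),
      forall u v v', A (u, v) -> A (u, v') -> v = v' %[ae mu],
      A (fun=> 0, fun=> 0) &
      forall (a : R[i]) u v u' v', A (u, v) -> A (u', v') ->
        A (fun x => a * u x + u' x, fun x => a * v x + v' x)].

Definition densely_defined A : Prop := L2 `<=` L2closure (dom A).

Definition adjoint A : opgraph :=
  [set wz | [/\ L2 wz.1, L2 wz.2 &
    forall u v, A (u, v) -> L2dot v wz.1 = L2dot u wz.2]].

Definition self_adjoint A : Prop :=
  [/\ is_linear_operator A, densely_defined A & A = adjoint A].

(* The closure with respect to the graph norm. *)
Definition graph_closure A : opgraph :=
  [set uv | [/\ L2 uv.1, L2 uv.2 &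
    forall e : R, 0 < e -> exists2 wz, A wz &
      L2norm (fun x => uv.1 x - wz.1 x) + L2norm (fun x => uv.2 x - wz.2 x)
        < e]].

(* Resolvent set and spectrum of A regarded as an operator on the closed
   subspace H of L^2(mu): lambda is in the resolvent set when A - lambda is a
   bijection from dom A onto H with bounded inverse. The bound below contains
   the injectivity. *)
Definition resolvent_set (H : set (T -> R[i])) A : set R[i] :=
  [set lambda |
    (forall g, H g -> exists u v, A (u, v) /\
        (fun x => v x - lambda * u x) = g %[ae mu]) /\
    exists C : R, forall u v, A (u, v) ->
        L2norm u <= C * L2norm (fun x => v x - lambda * u x)].

Definition spectrum (H : set (T -> R[i])) A : set R[i] :=
  ~` resolvent_set H A.

Definition eigenspace A (lambda : R[i]) : set (T -> R[i]) :=
  [set u | A (u, fun x => lambda * u x)].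

Definition lin_indep (k : nat) (u : 'I_k -> T -> R[i]) : Prop :=
  forall c : 'I_k -> R[i],
    (fun x => \sum_(i < k) c i * u i x) = (fun=> 0) %[ae mu] ->
    forall i, c i = 0.

(* The dimension, in N u {+oo}, of the eigenspace as a subspace of L^2(mu);
   it is 0 when lambda is not an eigenvalue. *)
Definition multiplicity A (lambda : R[i]) : \bar R :=
  ereal_sup [set k%:R%:E | k in [set k : nat |
    exists u : 'I_k -> T -> R[i],
      (forall i, eigenspace A lambda (u i)) /\ lin_indep u]].

End L2.

Arguments opgraph {R d} T.

(** * Metric graphs *)

(* Local finiteness makes the sums in the Kirchhoff conditions meaningful. A
   loop is an edge e with src e = tgt e; the orientation is only used to
   parametrize e by [0, len e]. *)
Record metric_graph (R : realType) := MetricGraph {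
  vertex : pointedType;
  edge : choiceType;
  src : edge -> vertex;
  tgt : edge -> vertex;
  len : edge -> R;
  len_gt0 : forall e, 0 < len e;
  vertex_on_edge : forall v, exists e, src e = v \/ tgt e = v;
  locally_finite : forall v, finite_set [set e | src e = v \/ tgt e = v] }.

Section MetricGraph.
Context {R : realType}.
Variable G : metric_graph R.

Variant gpoint : Type :=
  | Vertex of vertex G
  | Inner of {p : edge G * R | 0 < p.2 < len p.1}.

(* The parametrization of e by arc length. *)
Definition epoint (e : edge G) (t : R) : gpoint :=
  if insub (e, t) is Some p then Inner p
  else if t <= 0 then Vertex (src e) else Vertex (tgt e).

(* gpath x y l : some path made of finitely many pieces of edges joins x to y
   and has length l. *)
Inductive gpath : gpoint -> gpoint -> R -> Prop :=
  | gpath_nil x : gpath x x 0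
  | gpath_cons e s t y l : 0 <= s <= len e -> 0 <= t <= len e ->
      gpath (epoint e t) y l -> gpath (epoint e s) y (`|s - t| + l).

(* Points in different connected components are at distance +oo. *)
Definition gdist (x y : gpoint) : \bar R :=
  ereal_inf [set l%:E | l in [set l | gpath x y l]].

Definition gball (x : gpoint) (r : R) (y : gpoint) : Prop :=
  (gdist x y < r%:E)%E.

Lemma gballP x r y : gball x r y <-> exists2 l, gpath x y l & l < r.
Proof.
split=> [/ereal_inf_lt[_ [l xyl <-]] lr|[l xyl lr]]; first by exists l.
by apply: (@le_lt_trans _ _ l%:E); [apply: ereal_inf_lbound; exists l|].
Qed.

Lemma gpath_cat x y z l m : gpath x y l -> gpath y z m -> gpath x z (l + m).
Proof.
elim=> [w wzm|e s t w k s01 t01 _ IH wzm]; first by rewrite add0r.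
by rewrite -addrA; exact: gpath_cons (IH wzm).
Qed.

Lemma gpath_sym x y l : gpath x y l -> gpath y x l.
Proof.
elim=> [w|e s t w k s01 t01 _ IH]; first exact: gpath_nil.
rewrite addrC; apply: (gpath_cat IH); rewrite distrC -[X in gpath _ _ X]addr0.
by apply: gpath_cons => //; exact: gpath_nil.
Qed.

Lemma gball_center x (r : R) : 0 < r -> gball x r x.
Proof. by move=> r0; apply/gballP; exists 0 => //; exact: gpath_nil. Qed.

Lemma gball_sym x y (r : R) : gball x r y -> gball y r x.
Proof.
by move=> /gballP[l xyl lr]; apply/gballP; exists l => //; exact: gpath_sym.
Qed.

Lemma gball_triangle x y z (r s : R) :
  gball x r y -> gball y s z -> gball x (r + s) z.
Proof.
move=> /gballP[l xyl lr] /gballP[m yzm ms]; apply/gballP.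
by exists (l + m); [exact: gpath_cat yzm|exact: ltrD].
Qed.

HB.instance Definition _ := gen_eqMixin gpoint.
HB.instance Definition _ := gen_choiceMixin gpoint.
HB.instance Definition _ := isPointed.Build gpoint (Vertex point).
HB.instance Definition _ := hasNbhs.Build gpoint (nbhs_ (entourage_ gball)).
HB.instance Definition _ := Nbhs_isPseudoMetric.Build R gpoint
  erefl gball_center gball_sym gball_triangle erefl.

(* The Borel sigma-algebra. *)
HB.instance Definition _ :=
  Measurable.copy gpoint (g_sigma_algebraType (@open gpoint)).

(* f is the primitive of g on [0, l]. *)
Definition primitive (l : R) (f g : R -> R[i]) : Prop :=
  [/\ lebesgue_measure.-integrable `[0, l]
        (fun t => (complex.Re (g t))%:E),
      lebesgue_measure.-integrable `[0, l]
        (fun t => (complex.Im (g t))%:E) &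
      forall t, 0 <= t <= l ->
        f t = f 0 + cintegral lebesgue_measure `[0, t] g].

(* f restricted to [0, l] is in the Sobolev space H^2, with derivative f1
   (continuous up to the end points) and second derivative f2 in L^2. *)
Definition sobolev2 (l : R) (f f1 f2 : R -> R[i]) : Prop :=
  [/\ primitive l f f1, primitive l f1 f2 &
      sq_integrable lebesgue_measure `[0, l] f2].

(* The sum over the edge ends at v of the derivatives of f pointing away from
   v is zero, f1 e being the derivative of f along e in the direction from
   src e to tgt e. A loop at v contributes to both sums. *)
Definition kirchhoff (f1 : edge G -> R -> R[i]) (v : vertex G) : Prop :=
  \sum_(e \in [set e | src e = v]) f1 e 0 -
  \sum_(e \in [set e | tgt e = v]) f1 e (len e) = 0.

(* The operator f |-> - f'' with Kirchhoff conditions; g is f''. *)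
Definition graph_laplacian (mu : {measure set gpoint -> \bar R}) :
    opgraph gpoint :=
  [set uv | [/\ L2 mu uv.1, L2 mu uv.2 &
    exists f g : gpoint -> R[i], exists f1 : edge G -> R -> R[i],
      [/\ continuous f,
          forall e, sobolev2 (len e) (f \o epoint e) (f1 e) (g \o epoint e),
          forall v, kirchhoff f1 v,
          uv.1 = f %[ae mu] &
          uv.2 = (fun x => - g x) %[ae mu]]]].

End MetricGraph.

(** * Projective systems of quantum graphs *)

Record projective_system (R : realType) := ProjectiveSystem {
  qgraph : nat -> metric_graph R;
  bond : forall n, gpoint (qgraph n.+1) -> gpoint (qgraph n);
  bond_continuous : forall n, continuous (@bond n);
  bond_surjective : forall n y, exists x, @bond n x = y }.

Section ProjectiveSystem.
Context {R : realType}.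
Variable F : projective_system R.

Record plimit : Type := PLimit {
  coord : forall n, gpoint (qgraph F n);
  coord_bond : forall n, bond (coord n.+1) = coord n }.

Fixpoint thread (n : nat) : gpoint (qgraph F n) :=
  if n is m.+1 then sval (cid (bond_surjective (thread m))) else point.

Lemma thread_bond n : bond (thread n.+1) = thread n.
Proof. by rewrite /=; case: cid. Qed.

(* The sigma-algebra of the limit measure, generated by the coordinate maps.
   When the F_n are second countable it is the Borel sigma-algebra of the
   topology induced by the product. *)
Definition cylinders : set (set plimit) :=
  \bigcup_n [set (fun x => coord x n) @^-1` B | B in measurable].

HB.instance Definition _ := gen_eqMixin plimit.
HB.instance Definition _ := gen_choiceMixin plimit.
HB.instance Definition _ := isPointed.Build plimit (PLimit thread_bond).
HB.instance Definition _ :=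
  Measurable.copy plimit (g_sigma_algebraType cylinders).

Variable mun : forall n, {measure set (gpoint (qgraph F n)) -> \bar R}.
Variable mu : {measure set plimit -> \bar R}.

Definition compatible_measures : Prop :=
  (exists M : R, forall n, (mun n setT <= M%:E)%E) /\
  forall n B, measurable B -> mun n B = mun n.+1 (@bond _ F n @^-1` B).

Definition limit_measure : Prop :=
  forall n B, measurable B -> mun n B = mu ((fun x => coord x n) @^-1` B).

(* The operator (A_n, D_n) on L^2(mu). *)
Definition pullback n : opgraph plimit :=
  [set uv | [/\ L2 mu uv.1, L2 mu uv.2 &
    exists f g, [/\ graph_laplacian (mun n) (f, g),
      uv.1 = (fun x => f (coord x n)) %[ae mu] &
      uv.2 = (fun x => g (coord x n)) %[ae mu]]]].

Definition pdom n : set (plimit -> R[i]) := dom (pullback n).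

Definition orthodom n : set (plimit -> R[i]) :=
  if n is m.+1 then orthocompl mu (pdom m) `&` pdom m.+1 else pdom 0%N.

(* The minimal self-adjoint extension, with its domain being the closure of the
   union of the D_n in the graph norm. *)
Definition is_projective_limit (A : opgraph plimit) : Prop :=
  [/\ self_adjoint mu A,
      forall n, pullback n `<=` A,
      forall B, self_adjoint mu B -> (forall n, pullback n `<=` B) ->
        A `<=` B &
      A = graph_closure mu (\bigcup_n pullback n)].

(* A_n restricted to D'_n, as an operator on the closure of D'_n. The union of
   these spectra over n need not be closed: when F_n is the circle R/2^nZ with
   normalized length and bond n is the canonical projection, the limit is a
   solenoid and the union is the countable set of all (2 pi q)^2 with q a dyadic
   rational, while the spectrum of the limit operator is [0, +oo[. The spectrum
   of the limit is therefore compared with the closure of the union; the two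
   agree whenever the union is closed. *)
Definition orthospectrum n : set R[i] :=
  spectrum mu (L2closure mu (orthodom n)) (restrict (pullback n) (orthodom n)).

Definition orthomultiplicity n (lambda : R[i]) : \bar R :=
  multiplicity mu (restrict (pullback n) (orthodom n)) lambda.

End ProjectiveSystem.

(* Main.v *)
From HB Require Import structures.
Require Import Defs.
From mathcomp Require Import all_boot all_order all_algebra.
From mathcomp Require Import complex.
From mathcomp Require Import all_classical all_reals all_analysis.
From mathcomp Require Import measurable_realfun ring lra.
Set Implicit Arguments.
Unset Strict Implicit.
Unset Printing Implicit Defensive.
Import Order.TTheory GRing.Theory Num.Theory numFieldNormedType.Exports.
Local Open Scope classical_set_scope.
Local Open Scope ring_scope.
Local Open Scope complex_scope.

(* Let H_n be the closure of D_n in L^2(mu); it is a copy of L^2(mu_n), since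
   the n-th coordinate map preserves the measures. By self-adjointness the
   orthogonal projection onto H_(n-1) maps D_n into D_(n-1) and commutes with
   A_n, so that D_n is the orthogonal sum of D_(n-1) and D'_n, and A_n restricted
   to D'_n is self-adjoint on the closure of D'_n. For a self-adjoint operator B,
   lambda is in the resolvent set iff B - lambda is bounded below, and a ball
   around lambda avoiding the spectrum gives a lower bound that depends only on
   lambda and the radius. Lower bounds on all the D'_n that do not depend on n
   add up, by Pythagoras, to one on the union of the D_n and, passing to the graph
   closure, to one for A; this gives the spectrum. Eigenspaces split along the
   D'_n in the same way, and each eigenspace of A is the closure of the union of
   those of the A_n. If the dimensions of the latter are bounded, this increasing
   union is one of its terms, which is closed. *)

(** * Hilbert spaces *)

(** The obstacle is uniformity in [n]. That [l] is in every resolvent set gives for each [n] a bound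
    that may degenerate as [n] grows, so a whole ball around [l] must be used. The usual source of a
    bound depending on the ball alone is the equality of the norm of the resolvent with the inverse
    distance to the spectrum, which comes from the spectral theorem. Here an extremality argument
    replaces it: if [k] is the best lower bound of [|(B - t) u|^2 / |u|^2] and [c^2 = k] with [c]
    smaller than the radius, then [t + c] and [t - c] are in the resolvent set, and the
    factorization [(B - t)^2 - c^2 = (B - t + c)(B - t - c)] improves [k]. The real part of the
    inner product is enough since all the subspaces and graphs are stable under multiplication by
    [i], and it keeps the estimates in the ordered field [R]. Losses such as a factor 4 do no harm:
    only the positivity of a bound matters. *)

(* A complex Hilbert space is presented by the real part of its inner product,
   for which multiplication by i is an isometry. *)
Record hilbert (R : realType) := Hilbert {
  hcarrier :> lmodType R[i];
  rdot : hcarrier -> hcarrier -> R;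
  rdotDl : forall u u' v, rdot (u + u') v = rdot u v + rdot u' v;
  rdotZl : forall (r : R) u v, rdot (r%:C *: u) v = r * rdot u v;
  rdot_iZ : forall u v, rdot ('i *: u) ('i *: v) = rdot u v;
  rdotC : forall u v, rdot u v = rdot v u;
  rdot_ge0 : forall u, 0 <= rdot u u;
  rdot_eq0 : forall u, rdot u u = 0 -> u = 0;
  rdot_complete : forall u : nat -> hcarrier,
    (forall e, 0 < e -> exists N, forall m n, (N <= m)%N -> (N <= n)%N ->
      rdot (u m - u n) (u m - u n) < e) ->
    exists l, forall e, 0 < e -> exists N, forall n, (N <= n)%N ->
      rdot (u n - l) (u n - l) < e }.

(** The squared modulus with values in [R]: the norm of [R[i]] takes its values in [R[i]], out of
    reach of order arguments over [R]. *)
Definition csq {R : realType} (a : R[i]) : R :=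
  complex.Re a ^+ 2 + complex.Im a ^+ 2.

Lemma csq_ge0 {R : realType} (a : R[i]) : 0 <= csq a.
Proof. by rewrite addr_ge0 ?sqr_ge0. Qed.

Section InnerProduct.
Context {R : realType} {H : hilbert R}.
Implicit Types (u v w p q : H) (S : set H) (a : R[i]).

Definition sqn u : R := rdot u u.

Lemma sqn_ge0 u : 0 <= sqn u. Proof. exact: rdot_ge0. Qed.

Lemma rdotDr u v v' : rdot u (v + v') = rdot u v + rdot u v'.
Proof. by rewrite rdotC rdotDl ![rdot _ u]rdotC. Qed.

Lemma rdotNl u v : rdot (- u) v = - rdot u v.
Proof. by have := rdotZl (-1) u v; rewrite rmorphN1 scaleN1r mulN1r. Qed.

Lemma rdotNr u v : rdot u (- v) = - rdot u v.
Proof. by rewrite rdotC rdotNl rdotC. Qed.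

Lemma rdotBl u u' v : rdot (u - u') v = rdot u v - rdot u' v.
Proof. by rewrite rdotDl rdotNl. Qed.

Lemma rdotBr u v v' : rdot u (v - v') = rdot u v - rdot u v'.
Proof. by rewrite rdotDr rdotNr. Qed.

Lemma rdotZr (r : R) u v : rdot u (r%:C *: v) = r * rdot u v.
Proof. by rewrite rdotC rdotZl rdotC. Qed.

Lemma rdot0l v : rdot (0 : H) v = 0.
Proof. by rewrite -(subrr 0) rdotBl subrr. Qed.

Lemma rdot0r v : rdot v (0 : H) = 0.
Proof. by rewrite rdotC rdot0l. Qed.

(** An isometry of square -1 is skew-symmetric. *)
Lemma rdotiZl u v : rdot ('i *: u) v = - rdot u ('i *: v).
Proof.
by rewrite -(rdot_iZ u) scalerA -expr2 sqr_i scaleN1r rdotNr opprK.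
Qed.

Lemma rdotiZ u : rdot u ('i *: u) = 0.
Proof. by have := rdotiZl u u; rewrite rdotC => ?; lra. Qed.

Lemma scale_ReIm a u :
  a *: u = (complex.Re a)%:C *: u + (complex.Im a)%:C *: ('i *: u).
Proof. by rewrite scalerA -scalerDl [_ * 'i]mulrC -complexE. Qed.

Lemma rdot_conj a u v : rdot (a *: u) v = rdot u (a^* *: v).
Proof.
rewrite (scale_ReIm a u) (scale_ReIm a^*).
case: a => a b /=.
by rewrite rdotDl rdotDr !rdotZl !rdotZr rdotiZl; lra.
Qed.

Lemma sqnD u v : sqn (u + v) = sqn u + 2 * rdot u v + sqn v.
Proof. by rewrite /sqn !rdotDl !rdotDr [rdot v u]rdotC; lra. Qed.

Lemma sqnN u : sqn (- u) = sqn u.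
Proof. by rewrite /sqn rdotNl rdotNr opprK. Qed.

Lemma sqnB u v : sqn (u - v) = sqn u - 2 * rdot u v + sqn v.
Proof. by rewrite sqnD sqnN rdotNr; lra. Qed.

Lemma sqnBC u v : sqn (u - v) = sqn (v - u).
Proof. by rewrite -sqnN opprB. Qed.

Lemma sqn0 : sqn 0 = 0. Proof. exact: rdot0l. Qed.

Lemma sqnZ a u : sqn (a *: u) = (complex.Re a ^+ 2 + complex.Im a ^+ 2) * sqn u.
Proof.
rewrite scale_ReIm sqnD /sqn !rdotZl !rdotZr rdot_iZ rdotiZ.
by ring.
Qed.

Lemma sqnD_le u v : sqn (u + v) <= 2 * sqn u + 2 * sqn v.
Proof.
have := sqn_ge0 (u - v); rewrite sqnB sqnD => ?; lra.
Qed.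

Lemma sqnB_le u v w : sqn (u - w) <= 2 * sqn (u - v) + 2 * sqn (v - w).
Proof. by rewrite -[u - w](subrKA v) sqnD_le. Qed.

Lemma sqn_close u v w (e : R) : sqn (w - u) < e / 4 -> sqn (w - v) < e / 4 ->
  sqn (u - v) < e.
Proof. by have := sqnB_le u w v; rewrite (sqnBC u w); lra. Qed.

Lemma sqn_eq0 u : sqn u = 0 -> u = 0. Proof. exact: rdot_eq0. Qed.

Lemma sqn_lt_eq0 u : (forall e : R, 0 < e -> sqn u < e) -> u = 0.
Proof.
move=> h; apply: sqn_eq0; apply/eqP; rewrite eq_le sqn_ge0 andbT leNgt.
by apply/negP => /h; rewrite ltxx.
Qed.

Lemma CauchySchwarz u v : rdot u v ^+ 2 <= sqn u * sqn v.
Proof.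
have [v0|v0] := eqVneq (sqn v) 0.
  by rewrite (sqn_eq0 v0) rdot0r sqn0 mulr0 expr0n.
have vgt0 : 0 < sqn v by rewrite lt_def v0 sqn_ge0.
have := sqn_ge0 ((sqn v)%:C *: u - (rdot u v)%:C *: v).
rewrite sqnB !sqnZ /= !rdotZl !rdotZr => h.
have : 0 <= sqn v * (sqn u * sqn v - rdot u v ^+ 2).
  apply: le_trans h _; rewrite le_eqVlt; apply/orP; left; apply/eqP; ring.
by rewrite pmulr_rge0// subr_ge0.
Qed.

Definition subspace S : Prop :=
  S 0 /\ forall a u v, S u -> S v -> S (a *: u + v).

Definition hclosure S : set H :=
  [set u | forall e : R, 0 < e -> exists2 w, S w & sqn (u - w) < e].

Lemma subspaceZ S a u : subspace S -> S u -> S (a *: u).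
Proof. by move=> [S0 SL] Su; rewrite -[a *: u]addr0; exact: SL. Qed.

Lemma subspaceD S u v : subspace S -> S u -> S v -> S (u + v).
Proof. by move=> [S0 SL] Su Sv; rewrite -[u]scale1r; exact: SL. Qed.

Lemma subspaceB S u v : subspace S -> S u -> S v -> S (u - v).
Proof.
by move=> SS Su Sv; apply: subspaceD => //; rewrite -scaleN1r; exact: subspaceZ.
Qed.

Lemma subset_hclosure S : S `<=` hclosure S.
Proof. by move=> u Su e e0; exists u => //; rewrite subrr sqn0. Qed.

Lemma hclosureS S S' : S `<=` S' -> hclosure S `<=` hclosure S'.
Proof. by move=> SS' u Su e /Su[w Sw ?]; exists w => //; exact: SS'. Qed.

Lemma hclosure_id S : hclosure (hclosure S) `<=` hclosure S.
Proof.
move=> u Su e e0.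
have e4 : 0 < e / 4 by lra.
have [v Sv uv] := Su _ e4; have [w Sw vw] := Sv _ e4.
by exists w => //; have := sqnB_le u v w; lra.
Qed.

Lemma subspace_hclosure S : subspace S -> subspace (hclosure S).
Proof.
move=> SS; split=> [|a u v Su Sv e e0]; first exact/subset_hclosure/(SS.1).
set c := complex.Re a ^+ 2 + complex.Im a ^+ 2.
have c0 : 0 <= c by rewrite addr_ge0 ?sqr_ge0.
have ec : 0 < e / (4 * (1 + c)) by apply: divr_gt0 => //; lra.
have e4 : 0 < e / 4 by lra.
have [u' Su' uu'] := Su _ ec; have [v' Sv' vv'] := Sv _ e4.
exists (a *: u' + v'); first by apply: SS.2.
rewrite opprD addrACA -scalerBr; apply: le_lt_trans (sqnD_le _ _) _.
rewrite sqnZ -/c; rewrite ltr_pdivlMr in uu'; last by lra.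
have := sqn_ge0 (u - u'); nra.
Qed.

(** Continuity of the inner product, by Cauchy-Schwarz. *)
Lemma rdot_hclosure S u : (forall w, S w -> rdot u w = 0) ->
  forall w, hclosure S w -> rdot u w = 0.
Proof.
move=> uS w Sw; apply/eqP; rewrite -sqrf_eq0; apply/eqP.
apply/eqP; rewrite eq_le sqr_ge0 andbT leNgt; apply/negP => h.
(* At this distance Cauchy-Schwarz gives [rdot u w ^+ 2] a bound strictly smaller than itself; the 1
   avoids a division by zero. *)
have c0 : 0 < rdot u w ^+ 2 / (1 + sqn u).
  by apply: divr_gt0 => //; have := sqn_ge0 u; lra.
have [w' Sw'] := Sw _ c0; have := CauchySchwarz u (w - w').
rewrite rdotBr (uS _ Sw') subr0 => cs.
rewrite ltr_pdivlMr; last by have := sqn_ge0 u; lra.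
have := sqn_ge0 u; have := sqn_ge0 (w - w'); nra.
Qed.

(** [p] is the orthogonal projection of [u] onto the closure of [S]. Real orthogonality suffices: on
    a complex subspace it also holds against ['i *: w], hence for the complex inner product. *)
Definition projection S u p : Prop :=
  hclosure S p /\ forall w, S w -> rdot (u - p) w = 0.

Lemma projection_hclosure S u p : projection S u p ->
  forall w, hclosure S w -> rdot (u - p) w = 0.
Proof. by move=> [_ h]; exact: rdot_hclosure. Qed.

Lemma projection_sqn S u p : projection S u p -> sqn u = sqn (u - p) + sqn p.
Proof.
move=> up; have := projection_hclosure up up.1.
by rewrite -{2}(subrK p u) (sqnD (u - p)) => ->; rewrite mulr0 addr0.
Qed.

Lemma projection_id S u : hclosure S u -> projection S u u.
Proof. by move=> Su; split=> // w _; rewrite subrr rdot0l. Qed.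

Lemma projectionL S a u v p q : subspace S ->
  projection S u p -> projection S v q ->
  projection S (a *: u + v) (a *: p + q).
Proof.
move=> SS [Sp up] [Sq vq]; split; first by apply (subspace_hclosure SS).2.
move=> w Sw; rewrite opprD addrACA -scalerBr rdotDl rdot_conj up ?vq ?addr0//.
exact: subspaceZ.
Qed.

Lemma sqn_continuous u w (e : R) : 0 < e ->
  exists2 d : R, 0 < d & forall z, sqn (z - w) < d ->
    `|sqn (u - z) - sqn (u - w)| < e.
Proof.
move=> e0; set K := sqn (u - w); have K0 : 0 <= K := sqn_ge0 _.
(* The difference of the squared norms is [sqn (z - w)] minus twice a cross term. The first bound
   makes the square less than [e / 2]; by Cauchy-Schwarz the second makes the cross term less than
   [e / 4]. *)
exists (Num.min (e / 2) (e ^+ 2 / (16 * (1 + K)))).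
  rewrite lt_min; apply/andP; split; first by lra.
  by apply: divr_gt0; [rewrite exprn_gt0|lra].
move=> z; rewrite lt_min => /andP[z1 z2].
rewrite ltr_pdivlMr in z2; last by lra.
have -> : u - z = (u - w) - (z - w) by rewrite opprB subrKA.
rewrite sqnB -/K.
have := CauchySchwarz (u - w) (z - w); rewrite -/(sqn _) -/K.
move: z1 z2; have := sqn_ge0 (z - w).
set s := sqn (z - w); set r := rdot _ _ => s0 z1 z2 cs.
have : `|r| < e / 4.
  rewrite -ltr_sqr ?nnegrE ?normr_ge0//; last by lra.
  by rewrite real_normK ?num_real//; nra.
by rewrite ltr_norml => /andP[? ?]; rewrite ltr_norml; apply/andP; split; lra.
Qed.

Lemma projection_of_minimizer S u p : subspace S -> hclosure S p ->
  (forall w, S w -> sqn (u - p) <= sqn (u - w)) -> projection S u p.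
Proof.
move=> SS Sp hmin; split=> // w Sw.
have hmin' w' : hclosure S w' -> sqn (u - p) <= sqn (u - w').
  move=> Sw'; rewrite leNgt; apply/negP => h.
  have [|e e0 uw'] := @sqn_continuous u w' (sqn (u - p) - sqn (u - w')).
    by rewrite subr_gt0.
  have [z Sz zw'] := Sw' _ e0; rewrite sqnBC in zw'.
  have := uw' _ zw'; rewrite ltr_norml => /andP[_]; have := hmin _ Sz; lra.
have [w0|w0] := eqVneq (sqn w) 0; first by rewrite (sqn_eq0 w0) rdot0r.
have wgt0 : 0 < sqn w by rewrite lt_def w0 sqn_ge0.
set r := rdot (u - p) w.
(* The best step from [p] along [w]: it lowers the squared distance by [r ^+ 2 / sqn w], which must
   therefore be 0. *)
have : sqn (u - p) <= sqn (u - (p + (r / sqn w)%:C *: w)).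
  apply: hmin'; apply: subspaceD (subspace_hclosure SS) Sp _.
  by apply: subset_hclosure; exact: subspaceZ.
rewrite opprD addrA [in X in _ <= X]sqnB rdotZr sqnZ -/r /= expr0n /= addr0.
move=> h; have : r ^+ 2 / sqn w <= 0.
  have -> : r ^+ 2 / sqn w =
      2 * (r / sqn w * r) - (r / sqn w) ^+ 2 * sqn w by field.
  by lra.
rewrite ler_pdivrMr// mul0r => r2.
by apply/eqP; rewrite -sqrf_eq0 eq_le r2 sqr_ge0.
Qed.

(** A sequence in [S] minimizing the distance to [u] is Cauchy. As [S] need not be closed, its limit
    is only in the closure. *)
Lemma projection_exists S u : subspace S -> exists p, projection S u p.
Proof.
move=> SS.
pose D := [set sqn (u - w) | w in S].
have D0 : D !=set0 by exists (sqn (u - 0)), 0 => //; exact: SS.1.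
have Dlb : has_lbound D by exists 0 => _ [w _ <-]; exact: sqn_ge0.
have Dinf : has_inf D by split.
set d := inf D.
have dle w : S w -> d <= sqn (u - w).
  by move=> Sw; apply: ge_inf => //; exists w.
have /choice[f fS] : forall n, exists w,
    S w /\ sqn (u - w) < d + n.+1%:R^-1.
  move=> n; have n0 : 0 < n.+1%:R^-1 :> R by rewrite invr_gt0.
  by have [_ [w Sw <-] wd] := inf_adherent n0 Dinf; exists w.
(* Parallelogram identity: the midpoint of two terms is in [S], so its squared distance to [u] is at
   least [d]. *)
have mid m n : sqn (f m - f n) <= 2 * (m.+1%:R^-1 + n.+1%:R^-1).
  have Smid : S ((2^-1)%:C *: (f m + f n)).
    by apply: subspaceZ => //; apply: subspaceD => //; exact: (fS _).1.
  have := dle _ Smid.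
  have -> : u - (2^-1)%:C *: (f m + f n) =
      (2^-1)%:C *: ((u - f m) + (u - f n)).
    rewrite addrACA -opprD scalerBr; congr (_ - _).
    rewrite -[u + u]mulr2n -(scaler_nat 2 u) scalerA (_ : _ * _ = 1) ?scale1r//.
    by rewrite -(rmorph_nat (real_complex R)) -rmorphM mulVf// pnatr_eq0.
  rewrite sqnZ /= expr0n /= addr0 (sqnD (u - f m)).
  have [_] := fS m; have [_] := fS n.
  have -> : f m - f n = (u - f n) - (u - f m).
    by rewrite opprB [RHS]addrC subrKA.
  rewrite (sqnB (u - f n)) (rdotC (u - f n)).
  have -> : 2^-1 ^+ 2 = 4^-1 :> R by field.
  by move: m.+1%:R^-1 n.+1%:R^-1 => x y; lra.
have [l fl] : exists l, forall e : R, 0 < e -> exists N, forall n, (N <= n)%N ->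
    sqn (f n - l) < e.
  apply: rdot_complete => e e0.
  have e4 : 0 < e / 4 by lra.
  have [N _ Ne] := near_infty_natSinv_lt (PosNum e4).
  exists N => m n Nm Nn; apply: le_lt_trans (mid m n) _.
  have /= := Ne _ Nm; have /= := Ne _ Nn.
  by move: m.+1%:R^-1 n.+1%:R^-1 => x y; lra.
exists l; apply: projection_of_minimizer => //.
  move=> e e0; have [N Nl] := fl _ e0; exists (f N); first exact: (fS N).1.
  by rewrite sqnBC; exact: Nl.
move=> w Sw; apply: le_trans (dle _ Sw).
rewrite leNgt; apply/negP => dlt.
have e0 : 0 < (sqn (u - l) - d) / 2 by lra.
have [e' e'0 ul] := sqn_continuous u l e0.
have [N1 _ Ne] := near_infty_natSinv_lt (PosNum e0).
have [N2 Nl] := fl _ e'0.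
have := ul _ (Nl _ (leq_maxr N1 N2)); rewrite ltr_norml => /andP[+ _].
have /= := Ne _ (leq_maxl N1 N2); have [_] := fS (maxn N1 N2).
by move: _.+1%:R^-1 => x; lra.
Qed.

End InnerProduct.

(** * Self-adjoint operators *)

Section Operators.
Context {R : realType} {H : hilbert R}.
Implicit Types (u v w p q a b z : H) (B P : set (H * H)) (l : R[i]).

Definition odom B : set H := [set u | exists v, B (u, v)].

Definition linear_graph B : Prop := B (0, 0) /\
  forall c u v u' v', B (u, v) -> B (u', v') -> B (c *: u + u', c *: v + v').

Definition symmetric_graph B : Prop :=
  forall u v u' v', B (u, v) -> B (u', v') -> rdot v u' = rdot u v'.

(* B is a self-adjoint operator on the closure of its domain. *)
Definition hselfadjoint B : Prop :=
  [/\ linear_graph B, symmetric_graph B,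
      forall u v, B (u, v) -> hclosure (odom B) v &
      forall u w, hclosure (odom B) u -> hclosure (odom B) w ->
        (forall a b, B (a, b) -> rdot b u = rdot a w) -> B (u, w)].

(** The bound is on squared norms, so [c] is the square of the usual constant. *)
Definition lower_bound B l (c : R) : Prop :=
  forall u v, B (u, v) -> c * sqn u <= sqn (v - l *: u).

Definition hresolvent (S : set H) B : set R[i] :=
  [set l | (forall g, S g -> exists u v, B (u, v) /\ v - l *: u = g) /\
    exists C : R, forall u v, B (u, v) -> sqn u <= C * sqn (v - l *: u)].

Lemma subspace_odom B : linear_graph B -> subspace (odom B).
Proof.
move=> [B0 BL]; split; first by exists 0.
by move=> c u u' [v uv] [v' uv']; exists (c *: v + v'); exact: BL.
Qed.

Lemma linear_graphB B u v u' v' : linear_graph B ->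
  B (u, v) -> B (u', v') -> B (u - u', v - v').
Proof.
move=> [_ BL] uv uv'; have := BL (-1) _ _ _ _ uv' uv.
by rewrite !scaleN1r addrC [- v' + _]addrC.
Qed.

Lemma scale_subB l u v u' v' :
  (v - v') - l *: (u - u') = (v - l *: u) - (v' - l *: u').
Proof. by rewrite scalerBr !opprD !opprK addrACA. Qed.

(** The graph is closed: by maximality it is enough to prove [rdot b u = rdot a v] for [(a, b)] in
    [B], and this equality passes to limits. *)
Lemma hselfadjoint_closed B u v : hselfadjoint B ->
  (forall e : R, 0 < e -> exists w z, [/\ B (w, z), sqn (u - w) < e &
    sqn (v - z) < e]) -> B (u, v).
Proof.
move=> [_ Bsym Bran Bmax] uvB; apply: Bmax.
- by move=> e /uvB[w [z [wz uw _]]]; exists w => //; exists z.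
- apply: hclosure_id => e /uvB[w [z [wz _ vz]]]; exists z => //.
  exact: Bran wz.
move=> a b ab; apply/eqP; rewrite -subr_eq0 -sqrf_eq0 eq_le sqr_ge0 andbT.
set x := (_ - _) ^+ 2; rewrite leNgt; apply/negP => x0.
have [a0 b0] := (sqn_ge0 a, sqn_ge0 b).
(* Chosen so that [x <= 2 * rdot b (u - w) ^+ 2 + 2 * rdot a (v - z) ^+ 2] and Cauchy-Schwarz give
   [x < x]. *)
have e0 : 0 < x / (2 * (1 + sqn a + sqn b)) by apply: divr_gt0; lra.
have [w [z [wz uw vz]]] := uvB _ e0.
rewrite !ltr_pdivlMr in uw vz; try lra.
have xE : x = (rdot b (u - w) - rdot a (v - z)) ^+ 2.
  by rewrite /x !rdotBr (Bsym _ _ _ _ ab wz); congr (_ ^+ 2); lra.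
have := CauchySchwarz b (u - w); have := CauchySchwarz a (v - z).
have := sqn_ge0 (u - w); have := sqn_ge0 (v - z).
have : x <= 2 * rdot b (u - w) ^+ 2 + 2 * rdot a (v - z) ^+ 2.
  rewrite xE -subr_ge0; apply: le_trans (sqr_ge0 (rdot b (u - w) +
    rdot a (v - z))) _.
  by rewrite le_eqVlt; apply/orP; left; apply/eqP; ring.
nra.
Qed.

(* Compressing a symmetric extension B' of B to the closure of the domain of B
   gives B back: for (a, b) in B, <b, p> = <b, u> = <a, v> = <a, q>. *)
Lemma hselfadjoint_projection B B' u v p q :
  hselfadjoint B -> symmetric_graph B' -> B `<=` B' -> B' (u, v) ->
  projection (odom B) u p -> projection (odom B) v q -> B (p, q).
Proof.
move=> [_ Bsym Bran Bmax] B'sym BB' uv up vq.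
apply: Bmax; [exact: up.1|exact: vq.1|move=> a b ab].
have := projection_hclosure up (Bran _ _ ab); rewrite rdotC rdotBr.
have := vq.2 _ (ex_intro _ b ab); rewrite rdotC rdotBr.
have := B'sym _ _ _ _ (BB' _ ab) uv.
by move=> ? ? ?; lra.
Qed.

(** The left side is the imaginary part of [<B u, u>], which is real for a symmetric operator. *)
Lemma symmetric_rdotiZ B u v : linear_graph B -> symmetric_graph B ->
  B (u, v) -> rdot v ('i *: u) = 0.
Proof.
move=> [B0 BL] Bsym uv; have := BL 'i _ _ _ _ uv B0; rewrite !addr0 => iuv.
have := Bsym _ _ _ _ uv iuv; have := rdotiZl u v; rewrite [rdot _ v]rdotC.
by lra.
Qed.

(** The cross term vanishes because [<B u, u>] is real. Hence a non-real [l] always has the lower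
    bound [complex.Im l ^+ 2]. *)
Lemma sqn_shift B u v l : linear_graph B -> symmetric_graph B -> B (u, v) ->
  sqn (v - l *: u) =
  sqn (v - (complex.Re l)%:C *: u) + complex.Im l ^+ 2 * sqn u.
Proof.
move=> Blin Bsym uv; rewrite !sqnB !sqnZ /= expr0n /= addr0 scale_ReIm.
rewrite rdotDr !rdotZr (symmetric_rdotiZ Blin Bsym uv).
by ring.
Qed.

Lemma sqn_shift_conj B u v l : linear_graph B -> symmetric_graph B ->
  B (u, v) -> sqn (v - l^* *: u) = sqn (v - l *: u).
Proof.
move=> Blin Bsym uv; rewrite (sqn_shift l^* Blin Bsym uv).
by rewrite (sqn_shift l Blin Bsym uv); case: l => x y /=; rewrite sqrrN.
Qed.

(** The bound makes the preimages of a sequence converging to [g] Cauchy, and since the graph is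
    closed their limit is a preimage of [g]. *)
Lemma closed_range B l (C : R) g : hselfadjoint B ->
  (forall u v, B (u, v) -> sqn u <= C * sqn (v - l *: u)) ->
  hclosure [set w | exists u v, B (u, v) /\ v - l *: u = w] g ->
  exists u v, B (u, v) /\ v - l *: u = g.
Proof.
move=> SB BC gcl; have [Blin _ _ _] := SB.
have /choice[f fB] : forall n, exists x : H * H,
    B x /\ sqn (g - (x.2 - l *: x.1)) < n.+1%:R^-1.
  move=> n; have n0 : 0 < n.+1%:R^-1 :> R by rewrite invr_gt0.
  by have [_ [u [v [uv <-]]] ?] := gcl _ n0; exists (u, v).
have fB1 n : B ((f n).1, (f n).2) by have [+ _] := fB n; case: (f n).
have fB2 n : sqn (g - ((f n).2 - l *: (f n).1)) < n.+1%:R^-1 by have [] := fB n.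
have [u fu] : exists u, forall e : R, 0 < e -> exists N, forall n, (N <= n)%N ->
    sqn ((f n).1 - u) < e.
  apply: rdot_complete => e e0.
  have e4 : 0 < e / (4 * (1 + `|C|)).
    by apply: divr_gt0 => //; have := normr_ge0 C; lra.
  have [N _ Ne] := near_infty_natSinv_lt (PosNum e4).
  exists N => m n Nm Nn; apply: le_lt_trans (BC _ _ (linear_graphB Blin (fB1 m)
    (fB1 n))) _.
  rewrite scale_subB.
  have := fB2 m; have := fB2 n.
  set x := (f m).2 - l *: (f m).1; set y := (f n).2 - l *: (f n).1.
  have := sqnB_le x g y; rewrite [sqn (x - g)]sqnBC.
  have /= := Ne _ Nm; have /= := Ne _ Nn.
  move: m.+1%:R^-1 n.+1%:R^-1 => d d'.
  rewrite !ltr_pdivlMr; try by have := normr_ge0 C; lra.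
  move=> d'e de xy gy gx.
  have : C * sqn (x - y) <= `|C| * (2 * d + 2 * d').
    apply: (@le_trans _ _ (`|C| * sqn (x - y))).
      by apply: ler_wpM2r; [exact: sqn_ge0|exact: ler_norm].
    by apply: ler_wpM2l => //; lra.
  by have := sqn_ge0 (g - x); have := sqn_ge0 (g - y); lra.
exists u, (g + l *: u); split; last by rewrite addrK.
apply: hselfadjoint_closed => // e e0.
set d := e / (4 * (1 + csq l)).
have l0 := csq_ge0 l.
have d0 : 0 < d by apply: divr_gt0 => //; lra.
have [N1 _ Ne] := near_infty_natSinv_lt (PosNum d0).
have [N2 Nu] := fu _ d0.
set n := maxn N1 N2.
exists (f n).1, (f n).2; split => //.
  rewrite sqnBC; apply: lt_trans (Nu _ (leq_maxr _ _)) _.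
  rewrite /d ltr_pdivrMr; last by lra.
  by nra.
have -> : g + l *: u - (f n).2 =
    g - ((f n).2 - l *: (f n).1) - l *: ((f n).1 - u).
  by rewrite scalerBr !opprB -[RHS]addrA [in RHS](addrC (_ - _)) subrKA addrA.
apply: le_lt_trans (sqnD_le _ _) _; rewrite sqnN sqnZ -/(csq l).
have := lt_trans (fB2 n) (Ne n (leq_maxl _ _)); have := Nu n (leq_maxr _ _).
rewrite /= /d !ltr_pdivlMr; try lra.
have := sqn_ge0 (g - ((f n).2 - l *: (f n).1)).
have := sqn_ge0 ((f n).1 - u).
by nra.
Qed.

Lemma hresolventP B l : hselfadjoint B ->
  hresolvent (hclosure (odom B)) B l <->
  exists2 c : R, 0 < c & lower_bound B l c.
Proof.
move=> SB; have [Blin Bsym Bran Bmax] := SB; split.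
  move=> [_ [C BC]]; exists (1 + `|C|)^-1 => [|u v uv].
    by rewrite invr_gt0; have := normr_ge0 C; lra.
  rewrite ler_pdivrMl; last by have := normr_ge0 C; lra.
  have := BC _ _ uv; have := ler_norm C; have := sqn_ge0 (v - l *: u); nra.
move=> [c c0 Bc].
have BC : forall u v, B (u, v) -> sqn u <= c^-1 * sqn (v - l *: u).
  by move=> u v uv; rewrite ler_pdivlMl//; exact: Bc.
split; last by exists c^-1.
move=> g Hg; set S := [set w | exists u v, B (u, v) /\ v - l *: u = w].
have SS : subspace S.
  split; first by exists 0, 0; rewrite scaler0 subr0; split=> //; exact: Blin.1.
  move=> a _ _ [u [v [uv <-]]] [u' [v' [uv' <-]]].
  exists (a *: u + u'), (a *: v + v'); split; first exact: Blin.2.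
  rewrite scalerBr scalerDr opprD addrACA; congr (_ - _ + _).
  by rewrite !scalerA mulrC.
have domS := subspace_odom Blin.
have SH : S `<=` hclosure (odom B).
  move=> _ [u [v [uv <-]]]; apply: subspaceB (subspace_hclosure domS) _ _.
    exact: Bran uv.
  apply: subspaceZ (subspace_hclosure domS) _; apply: subset_hclosure.
  by exists v.
have [p gp] := projection_exists g SS.
(* With [p] the projection of [g] onto the closed range of [B - l], maximality turns the
   orthogonality of [g - p] to that range into an eigenvector equation at the conjugate of [l]. As
   [B - l] and [B - l^*] have the same norms on the domain, the lower bound forces [g = p]. *)
have : B (g - p, l^* *: (g - p)).
  have Hgp : hclosure (odom B) (g - p).
    apply: subspaceB (subspace_hclosure domS) Hg _.
    by apply: hclosure_id; apply: hclosureS SH _ gp.1.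
  apply: Bmax => //; first exact: subspaceZ (subspace_hclosure domS) Hgp.
  move=> a b ab; have := gp.2 (b - l *: a); rewrite rdotC rdotBl => h.
  have {h} := h (ex_intro _ a (ex_intro _ b (conj ab erefl))).
  by rewrite rdot_conj => ?; lra.
move=> /[dup] /Bc; rewrite -(conjcK l) => + gpB.
rewrite (sqn_shift_conj _ Blin Bsym gpB) !conjcK subrr sqn0 => sgp.
have : g - p = 0.
  by apply: sqn_eq0; have := sqn_ge0 (g - p); nra.
move/eqP; rewrite subr_eq0 => /eqP ->.
exact: closed_range SB BC gp.1.
Qed.

End Operators.

(** * Uniform lower bounds from gaps in the spectrum *)

Section SpectralGap.
Context {R : realType} {H : hilbert R}.
Implicit Types (u v w p q a b z : H) (B P : set (H * H)) (l : R[i]).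

(* With S := B - t, both S + c and S - c are bounded below, hence so is
   S^2 - c^2 by some d; here S x = u and S u = w. *)
Lemma lower_bound_sqr B t c (d d' : R) : linear_graph B -> 0 <= d ->
  lower_bound B (t + c)%:C d -> lower_bound B (t - c)%:C d' ->
  forall x u v, B (x, u + t%:C *: x) -> B (u, v) ->
    d * d' * sqn x <= sqn ((v - t%:C *: u) - (c ^+ 2)%:C *: x).
Proof.
move=> [B0 BL] d0 Bd Bd' x u v xu uv.
have := Bd' _ _ xu.
have -> : u + t%:C *: x - (t - c)%:C *: x = c%:C *: x + u.
  rewrite rmorphB scalerBl opprB [c%:C *: x - _]addrC addrA addrK.
  exact: addrC.
have /Bd := BL c%:C _ _ _ _ xu uv.
have -> : c%:C *: (u + t%:C *: x) + v - (t + c)%:C *: (c%:C *: x + u) =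
    (v - t%:C *: u) - (c ^+ 2)%:C *: x.
  set w := v - t%:C *: u; have -> : v = w + t%:C *: u by rewrite subrK.
  apply/eqP; rewrite subr_eq; apply/eqP.
  rewrite rmorphD scalerDl !scalerDr !scalerA -[c%:C * c%:C]rmorphM -expr2.
  rewrite [t%:C * c%:C]mulrC [X in _ = _ + X]addrC [RHS]addrA subrKA.
  by rewrite addrACA [_ + w]addrC.
have := sqn_ge0 x; nra.
Qed.

(** If the best constant [k] were below [r ^+ 2], then with [c ^+ 2 = k] both [t + c] and [t - c]
    would be in the resolvent set, and the product of their lower bounds would give a constant
    better than [k]. *)
Lemma spectral_gap B t (r : R) : hselfadjoint B -> 0 < r ->
  (forall s : R, `|s - t| < r -> hresolvent (hclosure (odom B)) B s%:C) ->
  lower_bound B t%:C (r ^+ 2).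
Proof.
move=> SB r0 rB; have [Blin Bsym Bran Bmax] := SB.
have := rB t; rewrite subrr normr0 => /(_ r0)[tsurj _].
have [c0 c0pos Bc0] : exists2 c : R, 0 < c & lower_bound B t%:C c.
  by apply/(hresolventP _ SB)/rB; rewrite subrr normr0.
move=> u0 v0 uv0; rewrite leNgt; apply/negP => lt0.
have u0pos : 0 < sqn u0.
  rewrite lt_def sqn_ge0 andbT; apply/eqP => u00.
  by move: lt0; rewrite u00 mulr0 ltNge sqn_ge0.
pose D := [set k : R | 0 <= k /\ lower_bound B t%:C k].
have Dub : ubound D (r ^+ 2).
  move=> k [k0 Bk]; rewrite leNgt; apply/negP => rk.
  have := Bk _ _ uv0; nra.
have Dsup : has_sup D.
  by split; [exists c0; split=> //; exact: ltW|exists (r ^+ 2)].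
set k := sup D.
(* Every admissible constant is at most the quotient at the violating pair [(u0, v0)], which is less
   than [r ^+ 2]; this leaves room to enlarge [k]. *)
have kr : k < r ^+ 2.
  apply: (@le_lt_trans _ _ (sqn (v0 - t%:C *: u0) / sqn u0)).
    apply: ge_sup; first by exists c0; split=> //; exact: ltW.
    by move=> c [_ Bc]; rewrite ler_pdivlMr//; exact: Bc.
  by rewrite ltr_pdivrMr.
have kc0 : c0 <= k.
  by apply: ub_le_sup; [exists (r ^+ 2)|split=> //; exact: ltW].
have k0 : 0 < k by exact: lt_le_trans kc0.
have Bk : lower_bound B t%:C k.
  move=> u v uv; have [u0'|u0'] := eqVneq (sqn u) 0.
    by rewrite u0' mulr0 sqn_ge0.
  have upos : 0 < sqn u by rewrite lt_def u0' sqn_ge0.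
  rewrite -ler_pdivlMr//; apply: ge_sup.
    by exists c0; split=> //; exact: ltW.
  by move=> c [_ Bc]; rewrite ler_pdivlMr//; exact: Bc.
set c := Num.sqrt k.
have cpos : 0 < c by rewrite sqrtr_gt0.
have ck : c ^+ 2 = k by rewrite sqr_sqrtr// ltW.
have cr : c < r by rewrite -ltr_sqr ?nnegrE ?ltW// ck.
have [d1 d1pos Bd1] : exists2 d : R, 0 < d & lower_bound B (t + c)%:C d.
  by apply/(hresolventP _ SB)/rB; rewrite addrAC subrr add0r gtr0_norm.
have [d2 d2pos Bd2] : exists2 d : R, 0 < d & lower_bound B (t - c)%:C d.
  by apply/(hresolventP _ SB)/rB; rewrite addrAC subrr add0r normrN gtr0_norm.
set d := d1 * d2 / r ^+ 2.
have dpos : 0 < d by rewrite divr_gt0 ?mulr_gt0// exprn_gt0.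
(* Both terms exceed [k], contradicting the supremum. The cap [r ^+ 2] disposes of the vectors that
   already satisfy the desired bound. *)
suff : D (Num.min (r ^+ 2) (k + d)).
  move=> /(ub_le_sup (ex_intro _ _ Dub)); rewrite -/k leNgt.
  by rewrite lt_min kr ltrDl dpos.
split=> [|u v uv]; first by rewrite le_min sqr_ge0/= addr_ge0// ltW.
have [rle|rgt] := leP (r ^+ 2 * sqn u) (sqn (v - t%:C *: u)).
  apply: le_trans rle; apply: ler_wpM2r; first exact: sqn_ge0.
  by rewrite ge_min lexx.
apply: (@le_trans _ _ ((k + d) * sqn u)).
  by apply: ler_wpM2r; [exact: sqn_ge0|rewrite ge_min lexx orbT].
have [x [xu]] : exists x xu, B (x, xu) /\ xu - t%:C *: x = u.
  by apply: tsurj; apply: subset_hclosure; exists v.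
move=> [Bx /eqP]; rewrite subr_eq => /eqP xuE; rewrite {xu}xuE in Bx.
have := lower_bound_sqr Blin (ltW d1pos) Bd1 Bd2 Bx uv; rewrite ck.
(* Here [(B - t) x = u]; write [w] for [(B - t) u]. Expanding [|w - k x|^2] with this value and
   [k |x|^2 <= |u|^2] gives [|w|^2 >= k |u|^2 + d1 d2 |x|^2]. *)
have wx : rdot (v - t%:C *: u) x = sqn u.
  rewrite rdotBl (Bsym _ _ _ _ uv Bx) rdotDr rdotZr rdotZl /sqn; lra.
rewrite sqnB rdotZr wx sqnZ /= expr0n /= addr0.
have := Bk _ _ Bx; rewrite addrK.
have := CauchySchwarz (v - t%:C *: u) x; rewrite wx -/(sqn _).
move: rgt; set s := sqn (v - _); set y := sqn u; set n := sqn x.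
move=> sy cs kn h.
have [n0 y0 s0] : [/\ 0 <= n, 0 <= y & 0 <= s] by split; exact: sqn_ge0.
have ypos : 0 < y by rewrite lt_def y0 andbT; apply/eqP => y1; nra.
(* Cauchy-Schwarz and the case assumption give [|u|^4 <= |w|^2 |x|^2 <= r^2 |u|^2 |x|^2]. This
   bounds [d1 d2 |x|^2] below by [d |u|^2], whence the division by [r ^+ 2] in [d]. *)
have yn : y <= r ^+ 2 * n.
  by rewrite -(ler_pM2l ypos); nra.
have : d * y <= d1 * d2 * n.
  rewrite /d mulrAC ler_pdivrMr ?exprn_gt0// -[leRHS]mulrA.
  by apply: ler_wpM2l; [rewrite mulr_ge0// ltW|rewrite [n * _]mulrC].
nra.
Qed.

End SpectralGap.

(** * The part of an operator orthogonal to a smaller self-adjoint one *)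

Section OrthogonalPart.
Context {R : realType} {H : hilbert R}.
Implicit Types (u v w p q a b z : H) (B P : set (H * H)) (l : R[i]).

Definition ortho_part P B : set (H * H) :=
  [set uv | B uv /\ forall w, odom P w -> rdot uv.1 w = 0].

Variables P B : set (H * H).
Hypotheses (SP : hselfadjoint P) (SB : hselfadjoint B) (PB : P `<=` B).

Lemma ortho_part_split u v : B (u, v) -> exists p q,
  [/\ P (p, q), ortho_part P B (u - p, v - q), projection (odom P) u p &
      projection (odom P) v q].
Proof.
move=> uv; have [Plin _ _ _] := SP; have [Blin Bsym _ _] := SB.
have [p up] := projection_exists u (subspace_odom Plin).
have [q vq] := projection_exists v (subspace_odom Plin).
have pq : P (p, q) by exact: (hselfadjoint_projection SP Bsym PB uv).
exists p, q; split=> //; split; last exact: up.2.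
by apply: (linear_graphB Blin) => //; exact: PB.
Qed.

Lemma ortho_part_ran u v w : ortho_part P B (u, v) -> odom P w ->
  rdot v w = 0.
Proof.
move=> [uv uP] [w' ww']; have [_ Bsym _ _] := SB; have [_ _ Pran _] := SP.
rewrite (Bsym _ _ _ _ uv (PB ww')).
exact: rdot_hclosure uP _ (Pran _ _ ww').
Qed.

(** Removing from an approximant [w] its projection [p] does not spoil the approximation: since [u]
    is orthogonal to [p], the squared distance drops by [sqn p]. *)
Lemma ortho_part_dense u : hclosure (odom B) u ->
  (forall w, odom P w -> rdot u w = 0) -> hclosure (odom (ortho_part P B)) u.
Proof.
move=> Bu uP e e0; have e4 : 0 < e / 4 by lra.
have [w [w' ww'] uw] := Bu _ e0.
have [p [q [pq ww'pq wp _]]] := ortho_part_split ww'.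
exists (w - p); first by exists (w' - q).
apply: le_lt_trans uw.
have Pp : odom P p by exists q.
have -> : u - (w - p) = (u - w) + p by rewrite opprB addrA addrAC.
rewrite sqnD; have : rdot (u - w) p = - sqn p.
  have := wp.2 _ Pp; rewrite !rdotBl (uP _ Pp) /sqn; lra.
by move=> ->; have := sqn_ge0 p; lra.
Qed.

Lemma hselfadjoint_ortho_part : hselfadjoint (ortho_part P B).
Proof.
have [Plin Psym Pran Pmax] := SP; have [Blin Bsym Bran Bmax] := SB.
have PBB : odom (ortho_part P B) `<=` odom B by move=> u [v [uv _]]; exists v.
have PBP u w : hclosure (odom (ortho_part P B)) u -> odom P w -> rdot u w = 0.
  move=> uPB Pw; rewrite rdotC; apply: rdot_hclosure uPB => x [y [_ +]].
  by rewrite rdotC; exact.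
split.
- split; first by split=> [|w _]; [exact: Blin.1|exact: rdot0l].
  move=> c u v u' v' [uv uP] [uv' uP']; split; first exact: Blin.2.
  move=> w Pw; rewrite /= rdotDl rdot_conj uP ?uP' ?addr0//.
  exact: subspaceZ (subspace_odom Plin) Pw.
- by move=> u v u' v' [uv _] [uv' _]; exact: Bsym.
- move=> u v uv; apply: ortho_part_dense => [|w Pw]; first exact: Bran uv.1.
  exact: ortho_part_ran uv Pw.
move=> u w uPB wPB uw; split; last by move=> x; exact: PBP.
apply: Bmax; [exact: hclosureS PBB _ uPB|exact: hclosureS PBB _ wPB|].
(* Maximality of [B] asks for a test against all of [B]. The component of [(a, b)] in [P]
   contributes 0 to both sides, so the hypothesis on the orthogonal part is enough. *)
move=> a b ab; have [p [q [pq abpq _ _]]] := ortho_part_split ab.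
have := uw _ _ abpq; rewrite !rdotBl.
have : rdot p w = 0 by rewrite rdotC; apply: PBP wPB _; exists q.
have : rdot q u = 0.
  by rewrite rdotC; apply: rdot_hclosure (Pran _ _ pq) => x; exact: PBP.
by move=> ? ?; lra.
Qed.

End OrthogonalPart.

(** * Resolvent set of the limit operator *)

Section ResolventSum.
Context {R : realType} {H : hilbert R}.
Variables (B : nat -> set (H * H)) (A : set (H * H)).
Hypothesis SB : forall n, hselfadjoint (B n).
Hypothesis BS : forall n, B n `<=` B n.+1.
Hypothesis SA : hselfadjoint A.
Hypothesis BA : forall n, B n `<=` A.
Hypothesis AB : forall u v, A (u, v) -> forall e : R, 0 < e ->
  exists n w z, [/\ B n (w, z), sqn (u - w) < e & sqn (v - z) < e].
Hypothesis Adense : forall u, hclosure (odom A) u.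
Implicit Types (u v w p q a b z : H) (l : R[i]).

(** The zero operator on the zero space precedes [B 0], so that [D'_0 = D_0] is an instance of the
    general construction. *)
Definition prev_op n : set (H * H) := if n is m.+1 then B m else [set (0, 0)].

Definition step_op n : set (H * H) := ortho_part (prev_op n) (B n).

Lemma hselfadjoint_prev n : hselfadjoint (prev_op n).
Proof.
case: n => [|n /=]; last exact: SB.
have dom0 u : hclosure (odom (prev_op 0)) u -> u = 0.
  move=> u0; apply: sqn_lt_eq0 => e /u0[w [w' [-> _]]].
  by rewrite subr0.
split.
- split=> //= c u v u' v' [-> ->] [-> ->].
  by rewrite !scaler0 addr0.
- by move=> u v u' v' [-> ->] [-> ->].
- by move=> u v [_ ->]; apply: subset_hclosure; exists 0.
by move=> u w /dom0 -> /dom0 ->.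
Qed.

Lemma prev_op_sub n : prev_op n `<=` B n.
Proof.
case: n => [_ ->|n /=]; last exact: BS.
by have [[]] := SB 0.
Qed.

Lemma hselfadjoint_step n : hselfadjoint (step_op n).
Proof.
exact: hselfadjoint_ortho_part (hselfadjoint_prev n) (SB n) (@prev_op_sub n).
Qed.

(** The operators [B n] keep the constant [c]. The factor 4 is lost in the graph closure, where
    [|a + b|^2 <= 2 |a|^2 + 2 |b|^2] is applied once to the argument and once to its image under
    [A - l]. *)
Lemma lower_bound_step l (c : R) : 0 < c ->
  (forall n, lower_bound (step_op n) l c) -> lower_bound A l (c / 4).
Proof.
move=> c0 Sc.
(* Pythagoras for [u] and for [v - l *: u], whose projection is [q - l *: p]. *)
have PB n : lower_bound (prev_op n) l c -> lower_bound (B n) l c.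
  move=> Pc u v uv; have [Plin _ _ _] := hselfadjoint_prev n.
  have [p [q [pq uvpq up vq]]] := ortho_part_split (hselfadjoint_prev n) (SB n)
    (@prev_op_sub n) uv.
  have := projectionL (- l) (subspace_odom Plin) up vq.
  rewrite !scaleNr ![- _ + _]addrC => /projection_sqn ->.
  rewrite -scale_subB (projection_sqn up) mulrDr.
  by apply: lerD; [exact: Sc uvpq|exact: Pc pq].
have Bc n : lower_bound (B n) l c.
  elim: n => [|n IH]; apply: PB => //= u v [-> ->].
  by rewrite sqn0 mulr0 sqn_ge0.
move=> u v uv; rewrite leNgt; apply/negP; rewrite -subr_gt0.
set D := _ - _ => D0; have l0 := csq_ge0 l.
(* The approximation errors enter [D] with total weight at most [c / 2 + 2 + 2 * csq l], so they
   account for no more than [D / 2]. *)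
have e0 : 0 < D / (c + 4 + 4 * csq l) by apply: divr_gt0 => //; lra.
have [n [w [z [wz]]]] := AB uv e0; rewrite !ltr_pdivlMr; try lra.
have := Bc n _ _ wz; have := sqnB_le u w 0; rewrite !subr0.
have := sqnD_le (v - l *: u) (- ((v - z) - l *: (u - w))).
rewrite sqnN scale_subB opprB addrC subrK.
have := sqnD_le (v - z) (- (l *: (u - w))); rewrite sqnN sqnZ scale_subB.
rewrite -/(csq l).
have := sqn_ge0 (u - w); have := sqn_ge0 (v - z).
rewrite /D; set x := sqn (u - w); set y := sqn (v - z).
by nra.
Qed.

(** The right side says that [l] is outside the closure of the union of the spectra of the
    [step_op n]. *)
Lemma resolvent_sum l : hresolvent setT A l <->
  exists2 r : R, 0 < r & forall n l', csq (l' - l) < r ->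
    hresolvent (hclosure (odom (step_op n))) (step_op n) l'.
Proof.
have [Alin Asym _ _] := SA.
have -> : [set: H] = hclosure (odom A) by apply/seteqP; split=> u _.
have stepA n : step_op n `<=` A by move=> x [/BA].
split.
  (* Moving from [l] to [l'] with [csq (l' - l) < c / 4] leaves the bound [c / 4], the same for all
     [n] because every [step_op n] is contained in [A]. *)
  move=> /(hresolventP _ SA)[c c0 Ac]; exists (c / 4); first by lra.
  move=> n l' ll'; apply/(hresolventP _ (hselfadjoint_step n)).
  exists (c / 4); first by lra.
  move=> u v /stepA/Ac.
  have -> : v - l *: u = (v - l' *: u) + (l' - l) *: u.
    by rewrite scalerBl addrA subrK.
  have := sqnD_le (v - l' *: u) ((l' - l) *: u); rewrite sqnZ -/(csq _).
  have := sqn_ge0 u; nra.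
move=> [r r0 rS]; apply/(hresolventP _ SA).
(* [spectral_gap] works at real points; elsewhere the imaginary part already gives a bound. *)
have [iml|iml] := eqVneq (complex.Im l) 0; last first.
  exists (complex.Im l ^+ 2); first by rewrite exprn_even_gt0.
  by move=> u v /(sqn_shift l Alin Asym) ->; rewrite lerDr sqn_ge0.
exists (r / 4); first by lra.
apply: lower_bound_step => // n; have -> : l = (complex.Re l)%:C.
  by case: l iml {rS} => x y /= ->.
rewrite -(sqr_sqrtr (ltW r0)); apply: spectral_gap.
- exact: hselfadjoint_step.
- by rewrite sqrtr_gt0.
move=> s; rewrite -ltr_sqr ?nnegrE ?sqrtr_ge0// sqr_sqrtr ?(ltW r0)//.
rewrite real_normK ?num_real// => sl; apply: rS.
by rewrite /csq; case: l iml sl => x y /= -> sl; rewrite subr0 expr0n addr0.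
Qed.

End ResolventSum.

(** * Dimensions of eigenspaces *)

Section Dimension.
Context {R : realType} {H : hilbert R}.
Implicit Types (u v w p q : H) (S : set H) (l : R[i]).

Definition hlin_indep k (u : 'I_k -> H) : Prop :=
  forall c : 'I_k -> R[i], \sum_(i < k) c i *: u i = 0 -> forall i, c i = 0.

Definition has_indep S k : Prop :=
  exists u : 'I_k -> H, (forall i, S (u i)) /\ hlin_indep u.

Definition hdim S : \bar R := ereal_sup [set k%:R%:E | k in has_indep S].

Lemma has_indep0 S : has_indep S 0.
Proof. by exists (fun=> 0); split=> [[]|? _ []]. Qed.

Lemma has_indep_subset S S' k : S `<=` S' -> has_indep S k -> has_indep S' k.
Proof. by move=> SS' [u [Su ui]]; exists u; split=> // i; exact: SS'. Qed.

Lemma has_indep_le S k m : (m <= k)%N -> has_indep S k -> has_indep S m.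
Proof.
move=> /subnKC <- [u [Su ui]]; exists (u \o lshift _); split=> [i|c c0 i].
  exact: Su.
pose c' (j : 'I_(m + (k - m))) :=
  match fintype.split j with inl i => c i | inr _ => 0 end.
have c'l j : c' (lshift _ j) = c j by rewrite /c' (unsplitK (inl j)).
have c'r j : c' (rshift _ j) = 0 by rewrite /c' (unsplitK (inr j)).
rewrite -c'l; apply: ui; rewrite big_split_ord/= [X in _ + X]big1 ?addr0.
  by under eq_bigr do rewrite c'l.
by move=> j _; rewrite c'r scale0r.
Qed.

Lemma hdim_ge0 S : (0 <= hdim S)%E.
Proof. by apply: ereal_sup_ubound; exists 0%N => //; exact: has_indep0. Qed.

Lemma hdim_ge S k : has_indep S k -> (k%:R%:E <= hdim S)%E.
Proof. by move=> Sk; apply: ereal_sup_ubound; exists k. Qed.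

Lemma le_hdim S S' : S `<=` S' -> (hdim S <= hdim S')%E.
Proof.
move=> SS'; apply: ge_ereal_sup => _ [k Sk <-]; apply: hdim_ge.
exact: has_indep_subset Sk.
Qed.

Lemma hdim_infinite S : (forall k, has_indep S k) -> hdim S = +oo%E.
Proof.
move=> Sk; apply/eqyP => r _; apply: le_trans (hdim_ge (Sk (Num.truncn r).+1)).
by rewrite lee_fin ltW// truncnS_gt.
Qed.

Lemma hdim_finite S m : has_indep S m -> ~ has_indep S m.+1 ->
  hdim S = m%:R%:E.
Proof.
move=> Sm SmN; apply/eqP; rewrite eq_le hdim_ge// andbT.
apply: ge_ereal_sup => _ [k Sk <-]; rewrite lee_fin ler_nat leqNgt.
by apply/negP => /has_indep_le/(_ Sk).
Qed.

Lemma has_indep_dec S : (forall k, has_indep S k) \/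
  exists m, has_indep S m /\ ~ has_indep S m.+1.
Proof.
have [|/existsNP[k Sk]] := pselect (forall k, has_indep S k); first by left.
right; elim: k Sk => [|k IH] Sk; first by case: Sk; exact: has_indep0.
by have [?|/IH] := pselect (has_indep S k); [exists k|].
Qed.

Lemma subspace_sum S k (c : 'I_k -> R[i]) (u : 'I_k -> H) : subspace S ->
  (forall i, S (u i)) -> S (\sum_(i < k) c i *: u i).
Proof.
move=> SS Su; elim/big_ind: _ => [|x y|i _]; first exact: SS.1.
  exact: subspaceD.
exact: subspaceZ.
Qed.

Lemma has_indep_cat S m n (e : 'I_m -> H) (f : 'I_n -> H) :
  (forall i, S (e i)) -> (forall j, S (f j)) ->
  (forall c d, \sum_(i < m) c i *: e i + \sum_(j < n) d j *: f j = 0 ->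
    (forall i, c i = 0) /\ (forall j, d j = 0)) ->
  has_indep S (m + n).
Proof.
move=> Se Sf ef.
pose u (j : 'I_(m + n)) :=
  match fintype.split j with inl i => e i | inr j => f j end.
have ul i : u (lshift _ i) = e i by rewrite /u (unsplitK (inl i)).
have ur i : u (rshift _ i) = f i by rewrite /u (unsplitK (inr i)).
exists u; split=> [j|c]; first by rewrite /u; case: fintype.split.
rewrite big_split_ord/=.
under eq_bigr do rewrite ul.
under [X in _ + X]eq_bigr do rewrite ur.
move=> /ef[cl cr] i; rewrite -(splitK i).
by case: fintype.split => j /=; [exact: cl|exact: cr].
Qed.

Lemma indep_span S m (e : 'I_m -> H) w : (forall i, S (e i)) ->
  hlin_indep e -> ~ has_indep S m.+1 -> S w ->
  exists c : 'I_m -> R[i], w = \sum_(i < m) c i *: e i.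
Proof.
move=> Se ei SmN Sw; apply: contrapT => wN; apply: SmN.
rewrite -addn1; apply: (has_indep_cat Se (fun=> Sw)) => c d.
rewrite big_ord1; have [d0|d0] := eqVneq (d ord0) 0.
  rewrite d0 scale0r addr0 => /ei c0; split=> // j.
  by rewrite (ord1 j).
move=> /eqP; rewrite addrC addr_eq0 => /eqP dw; exfalso; apply: wN.
exists (fun i => - (d ord0)^-1 * c i).
under eq_bigr do rewrite -scalerA.
rewrite -scaler_sumr scaleNr -scalerN -dw scalerA mulVf// scale1r.
by [].
Qed.

(* Steinitz: k combinations of m < k vectors admit a nontrivial relation, read
   off the left kernel of the coefficient matrix. *)
Lemma steinitz k m (w : 'I_k -> H) (e : 'I_m -> H) (M : 'M[R[i]]_(k, m)) :
  (forall j, w j = \sum_(i < m) M j i *: e i) -> hlin_indep w -> (k <= m)%N.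
Proof.
move=> wE wi; rewrite leqNgt; apply/negP => mk.
have : kermx M != 0.
  rewrite kermx_eq0 /row_free neq_ltn (leq_ltn_trans (rank_leq_col M))//.
move=> /rowV0Pn[r /sub_kermxP rM r0].
move/eqP: r0; apply; apply/rowP => j; rewrite mxE.
apply: (wi (fun j => r 0 j)) => /=.
under eq_bigr do rewrite wE scaler_sumr.
rewrite exchange_big/= big1// => i _.
under eq_bigr do rewrite scalerA.
rewrite -scaler_suml.
have /rowP/(_ i) := rM; rewrite !mxE => ->.
by rewrite scale0r.
Qed.

(** If neither summand is infinite-dimensional, maximal independent families of both are
    concatenated. Orthogonality gives their independence, and [steinitz] excludes a longer
    family. *)
Lemma hdim_orthogonal_sum S S1 S2 : subspace S1 -> subspace S2 ->
  S1 `<=` S -> S2 `<=` S -> (forall u w, S1 u -> S2 w -> rdot u w = 0) ->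
  (forall u, S u -> exists p, S1 p /\ S2 (u - p)) ->
  hdim S = (hdim S1 + hdim S2)%E.
Proof.
move=> SS1 SS2 S1S S2S S12 SD.
have [S1i|[a [S1a S1aN]]] := has_indep_dec S1.
  rewrite (hdim_infinite S1i) hdim_infinite.
    by rewrite addye// gt_eqF// (lt_le_trans _ (hdim_ge0 _)).
  by move=> k; exact: has_indep_subset (S1i k).
have [S2i|[b [S2b S2bN]]] := has_indep_dec S2.
  rewrite (hdim_infinite S2i) hdim_infinite.
    by rewrite addey// gt_eqF// (lt_le_trans _ (hdim_ge0 _)).
  by move=> k; exact: has_indep_subset (S2i k).
rewrite (hdim_finite S1a S1aN) (hdim_finite S2b S2bN) -EFinD -natrD.
have [e [S1e ei]] := S1a; have [f [S2f fi]] := S2b.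
have Sab : has_indep S (a + b).
  apply: (@has_indep_cat _ _ _ e f) => [i|j|c d cd0]; [exact/S1S|exact/S2S|].
  (* In a vanishing combination the two partial sums are opposite as well as orthogonal, so both are
     0. *)
  have : rdot (\sum_(i < a) c i *: e i) (\sum_(j < b) d j *: f j) = 0.
    by apply: S12; apply: subspace_sum.
  move/eqP: (cd0); rewrite addr_eq0 => /eqP ->; rewrite rdotNl => /eqP.
  rewrite oppr_eq0 => /eqP /sqn_eq0 d0.
  by move: cd0; rewrite d0 addr0 => /ei c0; split=> //; exact: fi.
apply: hdim_finite => // -[u [Su ui]].
have /choice[M uM] : forall j : 'I_(a + b).+1, exists M : 'I_(a + b) -> R[i],
    u j = \sum_(i < a + b) M i *:
      match fintype.split i with inl i => e i | inr j => f j end.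
  move=> j; have [p [S1p S2up]] := SD _ (Su j).
  have [c pE] := indep_span S1e ei S1aN S1p.
  have [d upE] := indep_span S2f fi S2bN S2up.
  exists (fun i => match fintype.split i with inl i => c i | inr j => d j end).
  rewrite big_split_ord/=; under eq_bigr do rewrite (unsplitK (inl _)).
  under [X in _ = _ + X]eq_bigr do rewrite (unsplitK (inr _)).
  by rewrite -pE -upE addrC subrK.
suff : ((a + b).+1 <= a + b)%N by rewrite ltnn.
apply: (steinitz (M := \matrix_(j, i) M j i)) ui => j; rewrite uM.
by apply: eq_bigr => i _; rewrite mxE.
Qed.

End Dimension.

(** * Eigenspaces of the limit operator *)

Section Multiplicity.
Context {R : realType} {H : hilbert R}.
Implicit Types (u v w p q : H) (l : R[i]).

Definition heigenspace (B : set (H * H)) l : set H :=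
  [set u | B (u, l *: u)].

Lemma subspace_heigenspace (B : set (H * H)) l : linear_graph B ->
  subspace (heigenspace B l).
Proof.
move=> [B0 BL]; split; first by rewrite /heigenspace /= scaler0.
move=> c u v Bu Bv; rewrite /heigenspace /= scalerDr.
have -> : l *: (c *: u) = c *: (l *: u) by rewrite !scalerA mulrC.
exact: BL.
Qed.

Lemma projectionZ (S : set H) c u p : subspace S -> projection S u p ->
  projection S (c *: u) (c *: p).
Proof.
move=> SS up; have S0 := projection_id (subset_hclosure SS.1).
by have := projectionL c SS up S0; rewrite !addr0.
Qed.

Lemma heigenspace_projection (B B' : set (H * H)) l u p :
  hselfadjoint B -> symmetric_graph B' -> B `<=` B' -> heigenspace B' l u ->
  projection (odom B) u p -> heigenspace B l p.
Proof.
move=> SB B'sym BB' B'u up; have [Blin _ _ _] := SB.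
apply: (hselfadjoint_projection SB B'sym BB' B'u up).
exact: projectionZ (subspace_odom Blin) up.
Qed.

Variables (B : nat -> set (H * H)) (A : set (H * H)).
Hypothesis SB : forall n, hselfadjoint (B n).
Hypothesis BS : forall n, B n `<=` B n.+1.
Hypothesis SA : hselfadjoint A.
Hypothesis BA : forall n, B n `<=` A.
Hypothesis AB : forall u v, A (u, v) -> forall e : R, 0 < e ->
  exists n w z, [/\ B n (w, z), sqn (u - w) < e & sqn (v - z) < e].

Lemma hdim_step l n : hdim (heigenspace (B n) l) =
  (hdim (heigenspace (prev_op B n) l) + hdim (heigenspace (step_op B n) l))%E.
Proof.
have [Blin Bsym _ _] := SB n.
have SP := hselfadjoint_prev SB n; have PB := prev_op_sub SB BS (n := n).
have [Plin _ _ _] := SP.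
have [Slin _ _ _] := hselfadjoint_step SB BS n.
apply: hdim_orthogonal_sum.
- exact: subspace_heigenspace.
- exact: subspace_heigenspace.
- by move=> u; exact: PB.
- by move=> u [].
- by move=> u w Pu [_ +]; rewrite rdotC; apply; exists (l *: u).
move=> u Bu; have [p up] := projection_exists u (subspace_odom Plin).
have Pp := heigenspace_projection SP Bsym PB Bu up.
exists p; split=> //; split; last exact: up.2.
rewrite /= scalerBr; apply: (linear_graphB Blin Bu); exact: PB.
Qed.

Lemma hdim_heigenspace_sum l n : hdim (heigenspace (B n) l) =
  (\sum_(0 <= i < n.+1) hdim (heigenspace (step_op B i) l))%E.
Proof.
elim: n => [|n IH]; rewrite hdim_step.
  rewrite big_nat1 -[RHS]add0e; congr (_ + _)%E.
  apply: (hdim_finite (has_indep0 _)) => -[u [u0 ui]].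
  have : 1 = 0 :> R[i].
    apply: (ui (fun=> 1) _ ord0); rewrite big_ord1 scale1r.
    by have [] := u0 ord0.
  by move/eqP; rewrite oner_eq0.
by rewrite big_nat_recr//= IH.
Qed.

Lemma B_homo m n : (m <= n)%N -> B m `<=` B n.
Proof.
by move=> /subnK <-; elim: (n - m)%N => // k IH; apply: subset_trans IH (@BS _).
Qed.

Lemma has_indep_heigenspace l k : has_indep (heigenspace A l) k ->
  exists n, has_indep (heigenspace (B n) l) k.
Proof.
move=> Ak; apply: contrapT => /forallNP BkN.
(* [m] is the largest dimension reached along the sequence. From [N] on the eigenspaces can no
   longer grow, so they all equal that of [B N]. *)
have [N [m [Bm BmN]]] : exists N m, has_indep (heigenspace (B N) l) m /\
    forall n, ~ has_indep (heigenspace (B n) l) m.+1.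
  elim: k {Ak} BkN => [|k IH] BkN; first by case: (BkN 0%N); exact: has_indep0.
  have [[n Bn]|/forallNP/IH//] :=
      pselect (exists n, has_indep (heigenspace (B n) l) k).
  by exists n, k.
have [e [Be ei]] := Bm; have [Blin Bsym _ _] := SB N.
have eigS n u : (N <= n)%N -> heigenspace (B n) l u -> heigenspace (B N) l u.
  move=> Nn Bu.
  have [c ->] := indep_span (fun i => B_homo Nn (Be i)) ei (BmN n) Bu.
  by apply: subspace_sum => //; exact: subspace_heigenspace.
apply: (BkN N); apply: has_indep_subset Ak => u Au.
have [_ Asym _ _] := SA.
apply: hselfadjoint_closed => // r r0.
(* At this distance both [u - p] and [l *: (u - p)] have squared norm less than [r]. The projection
   [p] is an eigenvector, which the approximant [w] need not be, and it is at least as close to [u]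
   as [w]. *)
have r'0 : 0 < r / (1 + csq l) by apply: divr_gt0 => //; have := csq_ge0 l; lra.
have [n [w [z [wz uw _]]]] := AB Au r'0.
have [Bnlin _ _ _] := SB (maxn N n).
have [p up] := projection_exists u (subspace_odom Bnlin).
have : heigenspace (B N) l p.
  apply: (@eigS (maxn N n)); first exact: leq_maxl.
  exact: (heigenspace_projection (SB _) Asym (@BA _) Au up).
move=> BNp; exists p, (l *: p).
have upw : sqn (u - p) <= sqn (u - w).
  have Bw : odom (B (maxn N n)) w.
    by exists z; apply: B_homo wz; exact: leq_maxr.
  rewrite -[u - w](subrKA p) (sqnD (u - p)).
  rewrite (projection_hclosure up); first by rewrite mulr0 addr0 lerDl sqn_ge0.
  apply: subspaceB (subspace_hclosure (subspace_odom Bnlin)) up.1 _.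
  exact: subset_hclosure.
split=> //; rewrite ?ltr_pdivlMr in uw; try by have := csq_ge0 l; lra.
  have := csq_ge0 l; have := sqn_ge0 (u - w); nra.
rewrite -scalerBr sqnZ -/(csq l).
have := csq_ge0 l; have := sqn_ge0 (u - w); nra.
Qed.

(** The partial sums are the dimensions of the eigenspaces of the [B n], whose supremum is that of
    [A] by [has_indep_heigenspace]. *)
Lemma hdim_series l : hdim (heigenspace A l) =
  (\sum_(0 <= n <oo) hdim (heigenspace (step_op B n) l))%E.
Proof.
set f := fun n => hdim (heigenspace (step_op B n) l).
have s_nd : {homo (fun n => \sum_(0 <= i < n) f i)%E : m n / (m <= n)%N >->
    (m <= n)%E}.
  apply/nondecreasing_seqP => n; rewrite big_nat_recr//= leeDl//.
  exact: hdim_ge0.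
apply/esym/cvg_lim => //.
have -> : hdim (heigenspace A l) =
    ereal_sup (range (fun n => \sum_(0 <= i < n) f i)%E).
  apply/eqP; rewrite eq_le; apply/andP; split.
    apply: ge_ereal_sup => _ [k /has_indep_heigenspace[n Bk] <-].
    apply: le_trans (hdim_ge Bk) _; rewrite hdim_heigenspace_sum.
    by apply: ereal_sup_ubound; exists n.+1.
  apply: ge_ereal_sup => _ [[|n] _ <-]; first by rewrite big_nil hdim_ge0.
  by rewrite -hdim_heigenspace_sum; apply: le_hdim => u; exact: BA.
exact: ereal_nondecreasing_cvgn.
Qed.

End Multiplicity.

(** * Completeness of L^2 *)

Section RealDot.
Context {R : realType} {d : measure_display} {T : measurableType d}.
Variable mu : {measure set T -> \bar R}.
Implicit Types (f g h : T -> R[i]).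

(** The real part of [L2dot]; the imaginary part is the same form with [g] replaced by ['i * g]. *)
Definition fdot f g : R := \int[mu]_x
  (complex.Re (f x) * complex.Re (g x) + complex.Im (f x) * complex.Im (g x)).

Lemma measurable_csq f : measurable_fun setT (fun x => complex.Re (f x)) ->
  measurable_fun setT (fun x => complex.Im (f x)) ->
  measurable_fun setT (fun x => csq (f x)).
Proof.
by move=> mr mi; apply: measurable_funD; exact: measurable_funX.
Qed.

Lemma L2_measurable_csq f : L2 mu f -> measurable_fun setT (fun x => csq (f x)).
Proof. by move=> [mr mi _]; exact: measurable_csq. Qed.

Lemma measurable_fdot f g : L2 mu f -> L2 mu g -> measurable_fun setT (fun x =>
  complex.Re (f x) * complex.Re (g x) + complex.Im (f x) * complex.Im (g x)).
Proof.
move=> [mr mi _] [mr' mi' _].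
by apply: measurable_funD; exact: measurable_funM.
Qed.

Lemma integrable_csq f : L2 mu f ->
  mu.-integrable setT (EFin \o (fun x => csq (f x))).
Proof.
move=> f2; apply/integrableP; split.
  exact/measurable_EFinP/L2_measurable_csq.
have [_ _] := f2; congr (_ < _)%E; apply: eq_integral => x _.
by rewrite /= ger0_norm// csq_ge0.
Qed.

Lemma integrable_fdot f g : L2 mu f -> L2 mu g -> mu.-integrable setT
  (EFin \o (fun x => complex.Re (f x) * complex.Re (g x) +
                     complex.Im (f x) * complex.Im (g x))).
Proof.
move=> f2 g2; apply: (le_integrable measurableT _ _
  (integrableD measurableT (integrable_csq f2) (integrable_csq g2))).
  exact/measurable_EFinP/measurable_fdot.
move=> x _; rewrite /= lee_fin /csq [leRHS]ger0_norm; last first.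
  by rewrite !addr_ge0 ?sqr_ge0.
move: (f x) (g x) => [a b] [a' b'] /=; rewrite ler_norml.
have := sqr_ge0 (a + a'); have := sqr_ge0 (a - a').
have := sqr_ge0 (b + b'); have := sqr_ge0 (b - b').
by have := sqr_ge0 a; have := sqr_ge0 b; have := sqr_ge0 a';
  have := sqr_ge0 b'; move=> *; apply/andP; split; nra.
Qed.

Lemma fdot_csqE f : L2 mu f -> ((fdot f f)%:E = \int[mu]_x (csq (f x))%:E)%E.
Proof.
move=> f2; rewrite /fdot /Rintegral fineK; first exact: eq_integral.
by apply: integrable_fin_num => //; exact: integrable_fdot.
Qed.

Lemma L2P f : measurable_fun setT (fun x => complex.Re (f x)) ->
  measurable_fun setT (fun x => complex.Im (f x)) ->
  (\int[mu]_x (csq (f x))%:E < +oo)%E -> L2 mu f.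
Proof. by []. Qed.

Lemma L20 : L2 mu (fun=> 0).
Proof.
split; [exact: measurable_cst|exact: measurable_cst|].
by under eq_integral do rewrite /= expr0n/= addr0; rewrite integral0.
Qed.

Lemma L2_lin (a : R[i]) f g :
  L2 mu f -> L2 mu g -> L2 mu (fun x => a * f x + g x).
Proof.
move=> f2 g2; have [mr mi _] := f2; have [mr' mi' _] := g2.
have RE x : complex.Re (a * f x + g x) = complex.Re a * complex.Re (f x) -
    complex.Im a * complex.Im (f x) + complex.Re (g x).
  by case: (a) (f x) (g x) => [? ?] [? ?] [? ?].
have IE x : complex.Im (a * f x + g x) = complex.Re a * complex.Im (f x) +
    complex.Im a * complex.Re (f x) + complex.Im (g x).
  by case: (a) (f x) (g x) => [? ?] [? ?] [? ?].
have mR : measurable_fun setT (fun x => complex.Re (a * f x + g x)).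
  under eq_fun do rewrite RE.
  apply: measurable_funD => //; apply: measurable_funB => //;
    exact: measurable_funM.
have mI : measurable_fun setT (fun x => complex.Im (a * f x + g x)).
  under eq_fun do rewrite IE.
  apply: measurable_funD => //; apply: measurable_funD => //;
    exact: measurable_funM.
apply: L2P => //.
have : mu.-integrable setT (fun x =>
    ((2 * csq a)%:E * (csq (f x))%:E + 2%:E * (csq (g x))%:E)%E).
  by apply: integrableD => //; apply: integrableZl => //; exact: integrable_csq.
move/integrableP => [mb]; apply: le_lt_trans; apply: ge0_le_integral => //.
- by move=> x _; rewrite lee_fin csq_ge0.
- apply/measurable_EFinP; apply: measurable_funD; exact: measurable_funX.
- exact: measurableT_comp.
move=> x _; rewrite /= lee_fin; apply: le_trans (ler_norm _).
rewrite /csq RE IE; move: (complex.Re a) (complex.Im a) => b c.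
move: (f x) (g x) => [p q] [s t] /=.
have := sqr_ge0 (b * p - c * q - s); have := sqr_ge0 (b * q + c * p - t).
by nra.
Qed.

Lemma eq_ae_fdot f g f' g' : L2 mu f -> L2 mu g -> L2 mu f' -> L2 mu g' ->
  f = f' %[ae mu] -> g = g' %[ae mu] -> fdot f g = fdot f' g'.
Proof.
move=> f2 g2 f'2 g'2 ff' gg'; rewrite /fdot /Rintegral; congr fine.
apply: ae_eq_integral => //; [exact/measurable_EFinP/measurable_fdot|
  exact/measurable_EFinP/measurable_fdot|].
move: ff' gg'; apply: filterS2 => x fx gx _.
by rewrite (fx I) (gx I).
Qed.

Lemma fdotC f g : fdot f g = fdot g f.
Proof.
by apply: eq_Rintegral => x _; rewrite mulrC [X in _ + X]mulrC.
Qed.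

Lemma fdotDl f g h : L2 mu f -> L2 mu g -> L2 mu h ->
  fdot (fun x => f x + g x) h = fdot f h + fdot g h.
Proof.
move=> f2 g2 h2; rewrite -RintegralD//; [|exact: integrable_fdot..].
apply: eq_Rintegral => x _.
by case: (f x) (g x) (h x) => [? ?] [? ?] [? ?] /=; ring.
Qed.

Lemma fdotZl (r : R) f g : L2 mu f -> L2 mu g ->
  fdot (fun x => r%:C * f x) g = r * fdot f g.
Proof.
move=> f2 g2; rewrite -RintegralZl//; last exact: integrable_fdot.
apply: eq_Rintegral => x _.
by case: (f x) (g x) => [? ?] [? ?] /=; ring.
Qed.

Lemma fdot_iZ f g : fdot (fun x => 'i * f x) (fun x => 'i * g x) = fdot f g.
Proof.
by apply: eq_Rintegral => x _; case: (f x) (g x) => [? ?] [? ?] /=; ring.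
Qed.

Lemma fdot_ge0 f : 0 <= fdot f f.
Proof. by apply: Rintegral_ge0 => x _; rewrite addr_ge0// -expr2 sqr_ge0. Qed.

Lemma fdot_eq0 f : L2 mu f -> fdot f f = 0 -> f = (fun=> 0) %[ae mu].
Proof.
move=> f2 f0; have := fdot_csqE f2; rewrite f0 => /esym f0'.
have : ae_eq mu setT (fun x => (csq (f x))%:E) (cst 0)%E.
  apply/ae_eq_integral_abs => //.
    exact/measurable_EFinP/L2_measurable_csq.
  rewrite -[RHS]f0'; apply: eq_integral => x _.
  by rewrite /= ger0_norm// csq_ge0.
apply: filterS => x /(_ I)[] /= h _; case: (f x) h => a b; rewrite /csq /=.
move=> /eqP; rewrite paddr_eq0 ?sqr_ge0// !sqrf_eq0 => /andP[/eqP -> /eqP ->].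
by [].
Qed.

Lemma L2dotE f g : L2dot mu f g = fdot f g +i* fdot f (fun x => 'i * g x).
Proof.
rewrite /L2dot /cintegral; congr (_ +i* _); apply: eq_Rintegral => x _;
  by case: (f x) (g x) => [? ?] [? ?] /=; ring.
Qed.

Lemma L2normE f : L2norm mu f = Num.sqrt (fdot f f).
Proof. by rewrite /L2norm L2dotE. Qed.

End RealDot.

Lemma limn_einf_le {R : realType} (u : (\bar R)^nat) (e : \bar R) N :
  (forall n, (N <= n)%N -> (u n <= e)%E) -> (limn_einf u <= e)%E.
Proof.
move=> ue; apply: le_trans (limn_einf_sup u) _.
rewrite limn_esup_lim; apply: lime_le; first exact: is_cvg_esups.
exists N => // n /= Nn; apply: ge_ereal_sup => _ [m /= nm <-].
by apply: ue; exact: leq_trans nm.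
Qed.

Lemma cvg_geometric_increments {R : realType} (u : R^nat) (K : R) :
  (forall j, (u j.+1 - u j) ^+ 2 * 4 ^+ j <= K) -> cvgn u.
Proof.
move=> uK.
have K0 : 0 <= K by apply: le_trans (uK 0%N); rewrite expr0 mulr1 sqr_ge0.
have -> : u = (fun n => u 0%N + series (telescope u) n).
  by apply/funext => n; rewrite -eq_sum_telescope.
apply: is_cvgD; first exact: is_cvg_cst.
apply: normed_cvg; apply: (@series_le_cvg _ _ (geometric (Num.sqrt K) 2^-1)).
- by move=> n; exact: normr_ge0.
- by move=> n; rewrite /= mulr_ge0 ?sqrtr_ge0 ?exprn_ge0.
- move=> n; rewrite /= /telescope -ler_sqr ?nnegrE ?normr_ge0//.
  rewrite real_normK ?num_real// exprMn sqr_sqrtr// -exprM mulnC exprM.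
  rewrite (_ : 2^-1 ^+ 2 = 4^-1 :> R); last by field.
  by rewrite exprVn ler_pdivlMr ?exprn_gt0 ?ltr0n //; exact: uK.
apply: is_cvg_geometric_series.
by rewrite ger0_norm ?invr_ge0// invf_lt1 ?ltr1n.
Qed.

Section Completeness.
Context {R : realType} {d : measure_display} {T : measurableType d}.
Variable mu : {measure set T -> \bar R}.

Lemma L2B (f g : T -> R[i]) : L2 mu f -> L2 mu g -> L2 mu (fun x => f x - g x).
Proof.
move=> f2 g2; have := L2_lin (-1) g2 f2.
by congr (L2 mu _); apply/funext => x; rewrite mulN1r addrC.
Qed.

Variable f : nat -> T -> R[i].
Hypothesis f2 : forall n, L2 mu (f n).

(** The series of the [4 ^+ j * csq (f j.+1 x - f j x)] has integral at most 1, hence is finite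
    almost everywhere. There the increments are at most a constant times [2 ^- j]. *)
Lemma ae_cvg_increments :
  (forall j, fdot mu (fun x => f j.+1 x - f j x) (fun x => f j.+1 x - f j x) <=
    (4 ^+ j)^-1 * (1 / (2 ^ j.+1)%:R)) ->
  {ae mu, forall x, cvgn (fun j => complex.Re (f j x)) /\
                    cvgn (fun j => complex.Im (f j x))}.
Proof.
move=> fS; pose h j x := ((4 ^+ j * csq (f j.+1 x - f j x))%:E : \bar R).
have h0 j x : (0 <= h j x)%E.
  by rewrite lee_fin mulr_ge0 ?csq_ge0 ?exprn_ge0.
have fB j : L2 mu (fun x => f j.+1 x - f j x) by exact: L2B.
have mh j : measurable_fun setT (h j).
  apply/measurable_EFinP; apply: measurable_funM => //.
  exact: L2_measurable_csq (fB j).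
have hint : mu.-integrable setT (fun x => \sum_(j <oo) h j x)%E.
  apply/integrableP; split; first by apply: ge0_emeasurable_sum.
  under eq_integral do rewrite gee0_abs ?nneseries_ge0//.
  rewrite integral_nneseries//.
  apply: (@le_lt_trans _ _ (\sum_(j <oo) (1 / (2 ^ j.+1)%:R)%:E)%E).
    apply: lee_nneseries => [j _ _|j _]; first by apply: integral_ge0 => x _.
    rewrite /h; under eq_integral do rewrite EFinM.
    rewrite ge0_integralZl//; last 2 first.
      exact/measurable_EFinP/L2_measurable_csq.
      by move=> x _; rewrite lee_fin csq_ge0.
    rewrite -fdot_csqE// -EFinM lee_fin mulrC -ler_pdivlMr ?exprn_gt0//.
    by rewrite mulrC.
  exact: le_lt_trans (epsilon_trick0 xpredT ler01) (ltry _).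
have := integrable_ae measurableT hint; apply: filterS => x /(_ I).
move=> /fineK xE.
have hK j : csq (f j.+1 x - f j x) * 4 ^+ j <= fine (\sum_(j <oo) h j x)%E.
  rewrite -lee_fin xE mulrC -/(h j x).
  apply: le_trans (nneseries_lim_ge j.+1 _) => //.
  by rewrite big_nat_recr//= leeDr// sume_ge0.
split; apply: (@cvg_geometric_increments _ _
    (fine (\sum_(j <oo) h j x)%E)) => j.
  apply: le_trans (hK j); apply: ler_wpM2r; first exact: exprn_ge0.
  by case: (f j.+1 x) (f j x) => [? ?] [? ?]; rewrite lerDl sqr_ge0.
apply: le_trans (hK j); apply: ler_wpM2r; first exact: exprn_ge0.
by case: (f j.+1 x) (f j x) => [? ?] [? ?]; rewrite lerDr sqr_ge0.
Qed.

End Completeness.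

Section RieszFischer.
Context {R : realType} {d : measure_display} {T : measurableType d}.
Variable mu : {measure set T -> \bar R}.
Variable f : nat -> T -> R[i].
Hypothesis f2 : forall n, L2 mu (f n).
Hypothesis fC : forall e : R, 0 < e -> exists N, forall m n,
  (N <= m)%N -> (N <= n)%N ->
  fdot mu (fun x => f m x - f n x) (fun x => f m x - f n x) < e.

(** A rapidly Cauchy subsequence converges almost everywhere, and Fatou's lemma upgrades this to
    convergence of the whole sequence in norm. *)
Lemma RieszFischer : exists2 g, L2 mu g & forall e : R, 0 < e -> exists N,
  forall n, (N <= n)%N ->
  fdot mu (fun x => f n x - g x) (fun x => f n x - g x) < e.
Proof.
have e0 j : 0 < (4 ^+ j)^-1 * (1 / (2 ^ j.+1)%:R) :> R.
  by rewrite mulr_gt0 ?invr_gt0 ?exprn_gt0// divr_gt0// ltr0n expn_gt0.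
have /choice[N fN] := fun j => fC (e0 j).
(* The maximum puts [phi j] and [phi j.+1] both beyond [N j]; the summand [j] makes [phi] tend to
   infinity. *)
pose phi j := (\max_(i < j.+1) N i + j)%N.
have phiN j k : (j <= k)%N -> (N j <= phi k)%N.
  move=> jk; apply: leq_trans (leq_addr _ _).
  exact: (@leq_bigmax _ (fun i : 'I_k.+1 => N i)
    (Ordinal (jk : (j < k.+1)%N))).
pose g j := f (phi j).
have gcvg : {ae mu, forall x, cvgn (fun j => complex.Re (g j x)) /\
                    cvgn (fun j => complex.Im (g j x))}.
  by apply: ae_cvg_increments => j; [exact: f2|apply/ltW/fN; exact: phiN].
(* Upper limits are defined and measurable everywhere, so the null set without convergence needs no
   separate treatment. *)
pose l x := fine (limn_esup (fun j => (complex.Re (g j x))%:E)) +i*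
            fine (limn_esup (fun j => (complex.Im (g j x))%:E)).
have ml : measurable_fun setT (fun x => complex.Re (l x)) /\
    measurable_fun setT (fun x => complex.Im (l x)).
  have mfe (h : nat -> T -> R) : (forall j, measurable_fun setT (h j)) ->
      measurable_fun setT (fun x => fine (limn_esup (fun j => (h j x)%:E))).
    move=> mh; apply: (measurableT_comp (fine_measurable measurableT)).
    by apply: measurable_fun_limn_esup => j; exact/measurable_EFinP.
  by split; apply: mfe => j; have [] := f2 (phi j).
have gl : {ae mu, forall x, complex.Re (g j x) @[j --> \oo] --> complex.Re (l x)
    /\ complex.Im (g j x) @[j --> \oo] --> complex.Im (l x)}.
  move: gcvg; apply: filterS => x [cr ci].
  have esupE (u : R^nat) : cvgn u -> fine (limn_esup (EFin \o u)) = limn u.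
    move=> cu; rewrite is_cvg_limn_esupE ?EFin_lim//.
    by apply/fine_cvgP; split; [exact: nearW|].
  by split; rewrite /l /= (esupE (fun j => _)).
have mfl n : measurable_fun setT (fun x => complex.Re (f n x - l x)) /\
    measurable_fun setT (fun x => complex.Im (f n x - l x)).
  have [mr mi _] := f2 n; split.
    rewrite (_ : (fun _ => _) =
        (fun x => complex.Re (f n x) - complex.Re (l x))).
      by apply: measurable_funB => //; exact: ml.1.
    by apply/funext => x; exact: raddfB.
  rewrite (_ : (fun _ => _) =
      (fun x => complex.Im (f n x) - complex.Im (l x))).
    by apply: measurable_funB => //; exact: ml.2.
  by apply/funext => x; exact: raddfB.
have fl e : 0 < e -> exists N', forall n, (N' <= n)%N ->
    (\int[mu]_x (csq (f n x - l x))%:E <= e%:E)%E.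
  move=> /fC[N' fN']; exists N' => n N'n.
  have mfg j : measurable_fun setT (fun x => (csq (f n x - g j x))%:E).
    by apply/measurable_EFinP/L2_measurable_csq/L2B; exact: f2.
  rewrite (ge0_ae_eq_integral
    (g := fun x => limn_einf (fun j => (csq (f n x - g j x))%:E))) //.
  - apply: le_trans (fatou _ _ _ _) _ => //.
      by move=> j x _; rewrite lee_fin csq_ge0.
    apply: (@limn_einf_le _ _ _ N') => j N'j.
    rewrite -fdot_csqE; last by apply: L2B => //; exact: f2.
    by rewrite lee_fin ltW// fN'// (leq_trans N'j)// leq_addl.
  - apply/measurable_EFinP/measurable_csq;
      by [exact: (mfl n).1|exact: (mfl n).2].
  - rewrite /limn_einf; apply: measurableT_comp => //.
    by apply: measurable_fun_limn_esup => j; exact: measurableT_comp.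
  - by move=> x _; rewrite lee_fin csq_ge0.
  - move=> x _; rewrite limn_einf_lim.
    apply: lime_ge; first exact: is_cvg_einfs.
    apply: nearW => j; apply: le_ereal_inf_tmp => _ [k _ <-].
    by rewrite lee_fin csq_ge0.
  move: gl; apply: filterS => x [lr li] _.
  apply/esym; apply: (cvg_limn_einf_sup _).1.
  apply/fine_cvgP; split; first exact: nearW.
  rewrite (_ : _ \o _ = (fun j =>
    (complex.Re (f n x) - complex.Re (g j x)) ^+ 2 +
    (complex.Im (f n x) - complex.Im (g j x)) ^+ 2)); last first.
    by apply/funext => j; rewrite /= /csq !raddfB.
  rewrite /csq !raddfB.
  by apply: cvgD; rewrite expr2; under eq_fun do rewrite expr2;
    apply: cvgM; apply: cvgB => //; exact: cvg_cst.
have l2 : L2 mu l.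
  have [N' /(_ N' (leqnn _)) fl1] := fl _ ltr01.
  have fl2 : L2 mu (fun x => f N' x - l x).
    by apply: L2P; [exact: (mfl N').1|exact: (mfl N').2|
      exact: le_lt_trans fl1 (ltry _)].
  have := L2B (f2 N') fl2; congr (L2 mu _); apply/funext => x.
  by rewrite subKr.
exists l => // e e0'; have e20 : 0 < e / 2 by lra.
have [N' fN'] := fl _ e20; exists N' => n N'n.
have := fN' _ N'n; rewrite -fdot_csqE; last by apply: L2B => //; exact: f2.
rewrite lee_fin; lra.
Qed.

End RieszFischer.

(** * The Hilbert space of classes of square-integrable functions *)

Lemma filterS4 {T : Type} {F : set_system T} {FF : Filter F}
  (P1 P2 P3 P4 Q : set T) : (forall x, P1 x -> P2 x -> P3 x -> P4 x -> Q x) ->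
  F P1 -> F P2 -> F P3 -> F P4 -> F Q.
Proof.
move=> h F1 F2 F3 F4; apply: filterS2 (filterI F1 F2) (filterI F3 F4).
by move=> x [? ?] [? ?]; exact: h.
Qed.

Section L2Space.
Context {R : realType} {d : measure_display} {T : measurableType d}.
Variable mu : {measure set T -> \bar R}.
Implicit Types (f g : T -> R[i]) (a b : R[i]).

(** A class is the set of all its square-integrable representatives, so that almost everywhere equal
    functions give equal elements, as the module axioms require. *)
Record l2space : Type := L2Class {
  l2set : set (T -> R[i]);
  l2setP : exists2 f, L2 mu f & l2set = [set g | L2 mu g /\ f = g %[ae mu]] }.

HB.instance Definition _ := gen_eqMixin l2space.
HB.instance Definition _ := gen_choiceMixin l2space.

Implicit Types (u v w : l2space).

Definition rep u : T -> R[i] := s2val (cid2 (l2setP u)).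

Lemma rep_L2 u : L2 mu (rep u).
Proof. by rewrite /rep; case: cid2. Qed.

Lemma l2setE u : l2set u = [set g | L2 mu g /\ rep u = g %[ae mu]].
Proof. by rewrite /rep; case: cid2. Qed.

Definition cls f (f2 : L2 mu f) : l2space :=
  L2Class (ex_intro2 _ _ f f2 erefl).

Lemma l2_ext u v : rep u = rep v %[ae mu] -> u = v.
Proof.
move=> uv; have : l2set u = l2set v.
  rewrite !l2setE; apply/seteqP; split=> g [g2 ug]; split=> //.
    by apply: ae_eq_trans ug; exact: ae_eq_sym.
  exact: ae_eq_trans ug.
case: u v {uv} => [S SP] [S' S'P] /= SS'; rewrite -{}SS' in S'P *.
by rewrite (Prop_irrelevance SP S'P).
Qed.

Lemma rep_cls f (f2 : L2 mu f) : rep (cls f2) = f %[ae mu].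
Proof.
have : l2set (cls f2) f by split=> //; exact: ae_eq_refl.
by rewrite l2setE => -[].
Qed.

Definition l2lin a u v : l2space := cls (L2_lin a (rep_L2 u) (rep_L2 v)).
Definition l2zero : l2space := cls (L20 mu).
Definition l2add u v := l2lin 1 u v.
Definition l2scale a u := l2lin a u l2zero.
Definition l2opp u := l2scale (-1) u.

Lemma rep0 : rep l2zero = (fun=> 0) %[ae mu]. Proof. exact: rep_cls. Qed.

Lemma rep_add u v : rep (l2add u v) = (fun x => rep u x + rep v x) %[ae mu].
Proof.
have := rep_cls (L2_lin 1 (rep_L2 u) (rep_L2 v)).
by apply: filterS => x /(_ I) /= h _; rewrite h mul1r.
Qed.

Lemma rep_scale a u : rep (l2scale a u) = (fun x => a * rep u x) %[ae mu].
Proof.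
have := rep_cls (L2_lin a (rep_L2 u) (rep_L2 l2zero)).
move: rep0; apply: filterS2 => x /(_ I) /= h0 /(_ I) /= h _.
by rewrite h h0 addr0.
Qed.

Lemma rep_opp u : rep (l2opp u) = (fun x => - rep u x) %[ae mu].
Proof.
have := rep_scale (-1) u.
by apply: filterS => x /(_ I) /= h _; rewrite h mulN1r.
Qed.

Lemma l2addA : associative l2add.
Proof.
move=> u v w; apply: l2_ext.
have := rep_add u (l2add v w); have := rep_add v w.
have := rep_add (l2add u v) w; have := rep_add u v.
apply: filterS4 => x /(_ I) h1 /(_ I) h2 /(_ I) h3 /(_ I) h4 _.
by rewrite h4 h3 h2 h1 addrA.
Qed.

Lemma l2addC : commutative l2add.
Proof.
move=> u v; apply: l2_ext; have := rep_add u v; have := rep_add v u.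
by apply: filterS2 => x /(_ I) h1 /(_ I) h2 _; rewrite h1 h2 addrC.
Qed.

Lemma l2add0 : left_id l2zero l2add.
Proof.
move=> u; apply: l2_ext; have := rep_add l2zero u; have := rep0.
by apply: filterS2 => x /(_ I) h1 /(_ I) h2 _; rewrite h2 h1 add0r.
Qed.

Lemma l2addN : left_inverse l2zero l2opp l2add.
Proof.
move=> u; apply: l2_ext; have := rep_add (l2opp u) u; have := rep_opp u.
have := rep0; apply: filterS3 => x /(_ I) h1 /(_ I) h2 /(_ I) h3 _.
by rewrite h3 h2 h1 addNr.
Qed.

HB.instance Definition _ :=
  GRing.isZmodule.Build l2space l2addA l2addC l2add0 l2addN.

Lemma l2scaleA a b u : l2scale a (l2scale b u) = l2scale (a * b) u.
Proof.
apply: l2_ext; have := rep_scale a (l2scale b u); have := rep_scale b u.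
have := rep_scale (a * b) u.
apply: filterS3 => x /(_ I) h1 /(_ I) h2 /(_ I) h3 _.
by rewrite h1 h3 h2 mulrA.
Qed.

Lemma l2scale1 : left_id 1 l2scale.
Proof.
move=> u; apply: l2_ext; have := rep_scale 1 u.
by apply: filterS => x /(_ I) h _; rewrite h mul1r.
Qed.

Lemma l2scaleDr : right_distributive l2scale +%R.
Proof.
move=> a u v; apply: l2_ext.
have := rep_scale a (l2add u v); have := rep_add u v.
have := rep_add (l2scale a u) (l2scale a v).
have := rep_scale a u; have := rep_scale a v.
move=> ae1 ae2 ae3 ae4 ae5.
apply: filterS4 (filterI ae1 ae2) ae3 ae4 ae5 => x [/(_ I) h1 /(_ I) h2].
by move=> /(_ I) h3 /(_ I) h4 /(_ I) h5 _; rewrite h3 h5 h4 h1 h2 mulrDr.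
Qed.

Lemma l2scaleDl u : {morph l2scale^~ u : a b / a + b}.
Proof.
move=> a b; apply: l2_ext; have := rep_scale (a + b) u.
have := rep_add (l2scale a u) (l2scale b u).
have := rep_scale a u; have := rep_scale b u.
apply: filterS4 => x /(_ I) h1 /(_ I) h2 /(_ I) h3 /(_ I) h4 _.
by rewrite h4 h3 h2 h1 mulrDl.
Qed.

HB.instance Definition _ := GRing.Zmodule_isLmodule.Build R[i] l2space
  l2scaleA l2scale1 l2scaleDr l2scaleDl.

Lemma repD u v : rep (u + v) = (fun x => rep u x + rep v x) %[ae mu].
Proof. exact: rep_add. Qed.

Lemma repZ a u : rep (a *: u) = (fun x => a * rep u x) %[ae mu].
Proof. exact: rep_scale. Qed.

Lemma repB u v : rep (u - v) = (fun x => rep u x - rep v x) %[ae mu].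
Proof.
have := repD u (- v); have := rep_opp v.
by apply: filterS2 => x /(_ I) h1 /(_ I) h2 _; rewrite h2 h1.
Qed.

Lemma L2D f g : L2 mu f -> L2 mu g -> L2 mu (fun x => f x + g x).
Proof.
move=> f2 g2; have := L2_lin 1 f2 g2.
by congr (L2 mu _); apply/funext => x; rewrite mul1r.
Qed.

Lemma L2Z a f : L2 mu f -> L2 mu (fun x => a * f x).
Proof.
move=> f2; have := L2_lin a f2 (L20 mu).
by congr (L2 mu _); apply/funext => x; rewrite addr0.
Qed.

Definition l2dot u v : R := fdot mu (rep u) (rep v).

Lemma l2dotE u v f g : L2 mu f -> L2 mu g -> rep u = f %[ae mu] ->
  rep v = g %[ae mu] -> l2dot u v = fdot mu f g.
Proof. by move=> f2 g2; apply: eq_ae_fdot => //; exact: rep_L2. Qed.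

Lemma l2dotDl u u' v : l2dot (u + u') v = l2dot u v + l2dot u' v.
Proof.
rewrite -fdotDl; [|exact: rep_L2..]; apply: l2dotE;
  [by apply: L2D; exact: rep_L2|exact: rep_L2|exact: repD|exact: ae_eq_refl].
Qed.

Lemma l2dotZl (r : R) u v : l2dot (r%:C *: u) v = r * l2dot u v.
Proof.
rewrite -fdotZl; [|exact: rep_L2..]; apply: l2dotE;
  [by apply: L2Z; exact: rep_L2|exact: rep_L2|exact: repZ|exact: ae_eq_refl].
Qed.

Lemma l2dot_iZ u v : l2dot ('i *: u) ('i *: v) = l2dot u v.
Proof.
rewrite -[RHS]fdot_iZ; apply: l2dotE; [| |exact: repZ|exact: repZ];
  by apply: L2Z; exact: rep_L2.
Qed.

Lemma l2dot_eq0 u : l2dot u u = 0 -> u = 0.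
Proof.
move=> /(fdot_eq0 (rep_L2 u)) u0; apply: l2_ext.
by apply: ae_eq_trans u0 _; apply: ae_eq_sym; exact: rep0.
Qed.

Lemma l2dotB u f : L2 mu f -> forall v, rep v = f %[ae mu] ->
  l2dot (u - v) (u - v) =
  fdot mu (fun x => rep u x - f x) (fun x => rep u x - f x).
Proof.
move=> f2 v vf.
have uvf : rep (u - v) = (fun x => rep u x - f x) %[ae mu].
  move: vf (repB u v).
  by apply: filterS2 => x /(_ I) h1 /(_ I) h2 _; rewrite h2 h1.
by apply: l2dotE => //; apply: L2B => //; exact: rep_L2.
Qed.

Lemma l2dot_complete (u : nat -> l2space) :
  (forall e, 0 < e -> exists N, forall m n, (N <= m)%N -> (N <= n)%N ->
    l2dot (u m - u n) (u m - u n) < e) ->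
  exists l, forall e, 0 < e -> exists N, forall n, (N <= n)%N ->
    l2dot (u n - l) (u n - l) < e.
Proof.
move=> uC; have [|e /uC[N uN]|f f2 uf] := @RieszFischer _ _ _ mu (rep \o u).
- by move=> n; exact: rep_L2.
- exists N => m n Nm Nn; have := uN _ _ Nm Nn.
  by rewrite (l2dotB _ (rep_L2 (u n)))//; exact: ae_eq_refl.
exists (cls f2) => e /uf[N uN]; exists N => n /uN.
by rewrite (l2dotB _ f2)//; exact: rep_cls.
Qed.

Definition L2H : hilbert R := @Hilbert R l2space l2dot l2dotDl l2dotZl l2dot_iZ
  (fun u v => fdotC mu (rep u) (rep v)) (fun u => fdot_ge0 mu (rep u))
  l2dot_eq0 l2dot_complete.

End L2Space.

(** * Operators on L^2 as operators on the Hilbert space of classes *)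

Section Lift.
Context {R : realType} {d : measure_display} {T : measurableType d}.
Variable mu : {measure set T -> \bar R}.
Implicit Types (f g : T -> R[i]) (S : set (T -> R[i])) (A : @opgraph R d T).
Implicit Types (u v w : L2H mu) (l : R[i]).

Definition saturated S : Prop := S `<=` L2 mu /\
  forall f g, S f -> L2 mu g -> f = g %[ae mu] -> S g.

Definition opsaturated A : Prop :=
  (forall f g, A (f, g) -> L2 mu f /\ L2 mu g) /\
  forall f g f' g', A (f, g) -> L2 mu f' -> L2 mu g' ->
    f = f' %[ae mu] -> g = g' %[ae mu] -> A (f', g').

(** Membership is tested on one chosen representative, which is independent of the choice when [S]
    is saturated. *)
Definition liftset S : set (L2H mu) := [set u | S (rep u)].

Definition lift A : set (L2H mu * L2H mu) := [set uv | A (rep uv.1, rep uv.2)].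

Lemma rep_refl u : rep u = rep u %[ae mu]. Proof. exact: ae_eq_refl. Qed.

Lemma liftset_cls S f (f2 : L2 mu f) : saturated S -> S f -> liftset S (cls f2).
Proof.
move=> [_ SS] Sf; apply: SS Sf (rep_L2 _) _; apply: ae_eq_sym.
exact: rep_cls.
Qed.

Lemma lift_cls A f g (f2 : L2 mu f) (g2 : L2 mu g) : opsaturated A ->
  A (f, g) -> lift A (cls f2, cls g2).
Proof.
move=> [_ SA] Afg; apply: SA Afg (rep_L2 _) (rep_L2 _) _ _; apply: ae_eq_sym;
  exact: rep_cls.
Qed.

Lemma saturated_dom A : opsaturated A -> saturated (dom A).
Proof.
move=> [A2 SA]; split=> [f [g /A2[]]//|f f' [g Afg] f'2 ff'].
have [_ g2] := A2 _ _ Afg.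
by exists g; apply: SA Afg f'2 g2 ff' _; exact: ae_eq_refl.
Qed.

Lemma odom_lift A : opsaturated A -> odom (lift A) = liftset (dom A).
Proof.
move=> SA; have [A2 SA'] := SA; apply/seteqP; split=> u [v Auv].
  by exists (rep v).
have [_ v2] := A2 _ _ Auv; exists (cls v2).
apply: SA' Auv (rep_L2 _) (rep_L2 _) _ _; first exact: ae_eq_refl.
by apply: ae_eq_sym; exact: rep_cls.
Qed.

Lemma sqn_rep u f : L2 mu f -> rep u = f %[ae mu] -> sqn u = fdot mu f f.
Proof. by move=> f2 uf; exact: l2dotE. Qed.

Lemma L2norm_ge0 f : 0 <= L2norm mu f. Proof. exact: sqrtr_ge0. Qed.

Lemma L2norm_sqr f : L2norm mu f ^+ 2 = fdot mu f f.
Proof. by rewrite L2normE sqr_sqrtr// fdot_ge0. Qed.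

Lemma sqn_rep_norm u f : L2 mu f -> rep u = f %[ae mu] ->
  sqn u = L2norm mu f ^+ 2.
Proof. by rewrite L2norm_sqr; exact: sqn_rep. Qed.

Lemma rep_cls_shift f g (f2 : L2 mu f) (g2 : L2 mu g) l :
  rep (cls g2 - l *: cls f2) = (fun x => g x - l * f x) %[ae mu].
Proof.
have := repB (cls g2) (l *: cls f2); have := repZ l (cls f2).
have := rep_cls f2; have := rep_cls g2.
apply: filterS4 => x /(_ I) h1 /(_ I) h2 /(_ I) h3 /(_ I) h4 _.
by rewrite h4 h3 h2 h1.
Qed.

Lemma rep_shift u v l :
  rep (v - l *: u) = (fun x => rep v x - l * rep u x) %[ae mu].
Proof.
have := repB v (l *: u); have := repZ l u.
by apply: filterS2 => x /(_ I) h1 /(_ I) h2 _; rewrite h2 h1.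
Qed.

Lemma L2_shift f g l : L2 mu f -> L2 mu g -> L2 mu (fun x => g x - l * f x).
Proof. by move=> f2 g2; apply: L2B => //; exact: L2Z. Qed.

Lemma liftset_L2closure S : saturated S ->
  liftset (L2closure mu S) = hclosure (liftset S).
Proof.
move=> SS; apply/seteqP; split=> u.
  move=> [u2 uS] e e0; have [|g Sg ug] := uS (Num.sqrt e).
    by rewrite sqrtr_gt0.
  have g2 := SS.1 _ Sg; exists (cls g2); first exact: liftset_cls.
  rewrite /sqn /= (l2dotB u g2); last exact: rep_cls.
  rewrite -L2norm_sqr -[e]sqr_sqrtr ?(ltW e0)//.
  by rewrite ltr_sqr ?nnegrE ?L2norm_ge0 ?sqrtr_ge0.
move=> uS; split; first exact: rep_L2.
move=> e e0; have e20 : 0 < e ^+ 2 by rewrite exprn_gt0.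
have [w Sw uw] := uS _ e20; exists (rep w) => //.
rewrite -ltr_sqr ?nnegrE ?L2norm_ge0 ?(ltW e0)// L2norm_sqr.
by rewrite -(l2dotB u (rep_L2 w) (rep_refl w)).
Qed.

Lemma resolvent_lift S A : saturated S -> opsaturated A ->
  resolvent_set mu S A = hresolvent (liftset S) (lift A).
Proof.
move=> SS SA; have [A2 SA'] := SA; apply/seteqP; split=> l [surj [C bnd]].
  split=> [g Sg|].
    have [u [v [Auv uvg]]] := surj _ Sg; have [u2 v2] := A2 _ _ Auv.
    exists (cls u2), (cls v2); split; first exact: lift_cls.
    by apply: l2_ext; apply: ae_eq_trans uvg; exact: rep_cls_shift.
  exists (C ^+ 2) => u v uv; have := bnd _ _ uv.
  rewrite (sqn_rep_norm (rep_L2 u) (rep_refl u)).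
  rewrite (sqn_rep_norm (L2_shift l (rep_L2 u) (rep_L2 v)) (rep_shift u v l)).
  rewrite -exprMn => h; rewrite ler_sqr ?nnegrE ?L2norm_ge0//.
  exact: le_trans (L2norm_ge0 _) h.
split=> [g Sg|].
  have g2 := SS.1 _ Sg.
  have [u [v [Auv uvg]]] := surj _ (liftset_cls g2 SS Sg).
  exists (rep u), (rep v); split=> //.
  apply: ae_eq_trans (rep_cls g2); rewrite -uvg.
  by apply: ae_eq_sym; exact: rep_shift.
(* [hresolvent] bounds squared norms, hence the root; [C] may be negative, hence the absolute
   value. *)
exists (Num.sqrt `|C|) => u v Auv; have [u2 v2] := A2 _ _ Auv.
have := bnd _ _ (lift_cls u2 v2 SA Auv).
rewrite (sqn_rep_norm u2 (rep_cls _)).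
rewrite (sqn_rep_norm (L2_shift l u2 v2) (rep_cls_shift u2 v2 l)) => h.
rewrite -ler_sqr ?nnegrE ?mulr_ge0 ?L2norm_ge0 ?sqrtr_ge0//.
rewrite exprMn (sqr_sqrtr (normr_ge0 C)); apply: le_trans h _.
by apply: ler_wpM2r; [exact: sqr_ge0|exact: ler_norm].
Qed.

Lemma rep_sum (J : Type) (r : seq J) (c : J -> R[i]) (u : J -> L2H mu)
    (f : J -> T -> R[i]) : (forall i, rep (u i) = f i %[ae mu]) ->
  rep (\sum_(i <- r) c i *: u i) =
    (fun x => \sum_(i <- r) c i * f i x) %[ae mu].
Proof.
move=> uf; elim: r => [|i r IH].
  rewrite big_nil; have := rep0 mu; apply: filterS => x /(_ I) h _.
  by rewrite h big_nil.
rewrite big_cons; have := repD (c i *: u i) (\sum_(i <- r) c i *: u i).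
have := repZ (c i) (u i); have := uf i; move: IH.
apply: filterS4 => x /(_ I) h1 /(_ I) h2 /(_ I) h3.
by move=> /(_ I) h4 _; rewrite h4 h3 h2 h1 big_cons.
Qed.

Lemma lin_indep_rep k (u : 'I_k -> L2H mu) (f : 'I_k -> T -> R[i]) :
  (forall i, rep (u i) = f i %[ae mu]) -> lin_indep mu f <-> hlin_indep u.
Proof.
move=> uf; split=> fi c c0 i; apply: fi.
  apply: ae_eq_trans (rep0 mu); apply: ae_eq_sym.
  by have := rep_sum (index_enum 'I_k) c uf; rewrite c0.
apply: l2_ext; apply: ae_eq_trans (rep_sum _ c uf) _.
by apply: ae_eq_trans c0 _; apply: ae_eq_sym; exact: rep0.
Qed.

Lemma multiplicity_lift A l : opsaturated A ->
  multiplicity mu A l = hdim (heigenspace (lift A) l).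
Proof.
move=> SA; have [A2 SA'] := SA; congr (ereal_sup [set k%:R%:E | k in _]).
apply/seteqP; split=> k [u [Au ui]].
  have u2 i : L2 mu (u i) by have [] := A2 _ _ (Au i).
  exists (fun i => cls (u2 i)); split=> [i|].
    apply: SA' (Au i) (rep_L2 _) (rep_L2 _) _ _; apply: ae_eq_sym.
      exact: rep_cls.
    have := repZ l (cls (u2 i)); have := rep_cls (u2 i).
    by apply: filterS2 => x /(_ I) h1 /(_ I) h2 _; rewrite h2 h1.
  by apply/(lin_indep_rep (f := u)) => // i; exact: rep_cls.
exists (fun i => rep (u i)); split=> [i|].
  apply: SA' (Au i) (rep_L2 _) (L2Z l (rep_L2 _)) _ _.
    exact: ae_eq_refl.
  exact: repZ.
by apply/(lin_indep_rep (u := u)) => // i; exact: ae_eq_refl.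
Qed.

End Lift.

(** * Pull-back of operators along measure-preserving maps *)

Section MeasurePreserving.
Context {R : realType} {d d' : measure_display}.
Context {X : measurableType d} {Y : measurableType d'}.
Variables (mu : {measure set X -> \bar R}) (nu : {measure set Y -> \bar R}).
Variable phi : X -> Y.
Hypothesis mphi : measurable_fun setT phi.
Hypothesis nuE : forall B, measurable B -> nu B = mu (phi @^-1` B).
Implicit Types (f g h : Y -> R[i]).

Let mphi_mixin := isMeasurableFun.Build _ _ _ _ _ mphi.
Let mfphi : {mfun X >-> Y} := HB.pack phi mphi_mixin.

Lemma L2_comp f : L2 nu f -> L2 mu (fun x => f (phi x)).
Proof.
move=> f2; have [mr mi foo] := f2; split.
- exact: (measurableT_comp mr mphi).
- exact: (measurableT_comp mi mphi).
move: foo; rewrite (eq_measure_integral (pushforward mu mfphi)).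
  rewrite ge0_integral_pushforward//=.
    by apply/measurable_EFinP; exact: (L2_measurable_csq f2).
  by move=> y _; rewrite lee_fin addr_ge0 ?sqr_ge0.
by move=> B mB _; rewrite nuE.
Qed.

Lemma fdot_comp f g : L2 nu f -> L2 nu g ->
  fdot mu (fun x => f (phi x)) (fun x => g (phi x)) = fdot nu f g.
Proof.
move=> f2 g2; rewrite /fdot /Rintegral; congr fine.
rewrite [RHS](eq_measure_integral (pushforward mu mfphi)); last first.
  by move=> B mB _; rewrite nuE.
rewrite [RHS](integral_pushforward mphi)//=.
  by apply/measurable_EFinP; exact: (measurable_fdot f2 g2).
exact: (integrable_fdot (L2_comp f2) (L2_comp g2)).
Qed.

Lemma fdot_iZr f g :
  fdot nu f (fun y => 'i * g y) = fdot nu (fun y => - 'i * f y) g.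
Proof.
by apply: eq_Rintegral => y _; case: (f y) (g y) => [? ?] [? ?] /=; ring.
Qed.

Definition comp_cls f (f2 : L2 nu f) : L2H mu := cls (L2_comp f2).

Lemma rep_comp_cls f (f2 : L2 nu f) :
  rep (comp_cls f2) = (fun x => f (phi x)) %[ae mu].
Proof. exact: rep_cls. Qed.

(* The image of L^2(nu) in L^2(mu) is closed because L^2(nu) is complete. *)
Lemma closed_range_comp (S : set (L2H mu)) u :
  (forall w, S w ->
    exists2 f, L2 nu f & rep w = (fun x => f (phi x)) %[ae mu]) ->
  hclosure S u ->
  exists2 f, L2 nu f & rep u = (fun x => f (phi x)) %[ae mu].
Proof.
move=> SP uS.
have /choice[f fP] : forall n, exists f, L2 nu f /\ forall f2 : L2 nu f,
    sqn (u - comp_cls f2) < n.+1%:R^-1.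
  move=> n; have n0 : 0 < n.+1%:R^-1 :> R by rewrite invr_gt0.
  have [w Sw uw] := uS _ n0; have [f f2 wf] := SP _ Sw.
  exists f; split=> [|f2']; first exact: f2.
  suff wE : w = comp_cls f2' by rewrite -wE; exact: uw.
  apply: l2_ext; apply: ae_eq_trans wf _; apply: ae_eq_sym.
  exact: rep_comp_cls.
have f2 n : L2 nu (f n) by have [] := fP n.
have uf n : sqn (u - comp_cls (f2 n)) < n.+1%:R^-1.
  by have [_] := fP n; exact.
have fdotB g h (g2 : L2 nu g) (h2 : L2 nu h) :
    sqn (comp_cls g2 - comp_cls h2) =
    fdot nu (fun y => g y - h y) (fun y => g y - h y).
  rewrite -(fdot_comp (L2B g2 h2) (L2B g2 h2)); apply: sqn_rep.
    exact: L2_comp (L2B g2 h2).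
  have := repB (comp_cls g2) (comp_cls h2).
  have := rep_comp_cls g2; have := rep_comp_cls h2.
  by apply: filterS3 => x /(_ I) h1 /(_ I) h2' /(_ I) h3 _; rewrite h3 h2' h1.
have [e e0|g g2 fg] := @RieszFischer _ _ _ nu f f2.
  have e4 : 0 < e / 4 by lra.
  have [N _ Ne] := near_infty_natSinv_lt (PosNum e4).
  exists N => m n Nm Nn; rewrite -fdotB.
  by apply: (sqn_close (w := u)); [exact: lt_trans (uf m) (Ne _ Nm)|
    exact: lt_trans (uf n) (Ne _ Nn)].
exists g => //; suff -> : u = comp_cls g2 by exact: rep_comp_cls.
apply/eqP; rewrite -subr_eq0; apply/eqP/sqn_lt_eq0 => e e0.
have e4 : 0 < e / 4 by lra.
have [N1 _ Ne] := near_infty_natSinv_lt (PosNum e4).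
have [N2 Ng] := fg _ e4.
apply: (sqn_close (w := comp_cls (f2 (maxn N1 N2)))).
  by rewrite sqnBC; exact: lt_trans (uf _) (Ne _ (leq_maxl N1 N2)).
rewrite fdotB; exact: Ng _ (leq_maxr N1 N2).
Qed.

Definition pull (A : @opgraph R d' Y) : @opgraph R d X :=
  [set uv | [/\ L2 mu uv.1, L2 mu uv.2 &
    exists f g, [/\ A (f, g), uv.1 = (fun x => f (phi x)) %[ae mu] &
      uv.2 = (fun x => g (phi x)) %[ae mu]]]].

Lemma opsaturated_pull A : opsaturated mu (pull A).
Proof.
split=> [f g []//|u v u' v' [_ _ [f [g [fg uf vg]]]] u'2 v'2 uu' vv'].
split=> //; exists f, g; split=> //.
  by apply: ae_eq_trans uf; exact: ae_eq_sym.
by apply: ae_eq_trans vg; exact: ae_eq_sym.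
Qed.

(** Elements of the closure of the domain factor through [phi], by [closed_range_comp]. Composition
    with [phi] preserves inner products, so density of the domain of [A] gives the range condition
    and [A = adjoint A] gives maximality. *)
Lemma hselfadjoint_pull A :
  self_adjoint nu A -> hselfadjoint (lift (mu := mu) (pull A)).
Proof.
move=> [[A2 Asat Afun A0 AL] Adense Aadj].
set B := lift _.
have pullA f g : A (f, g) -> forall (f2 : L2 nu f) (g2 : L2 nu g),
    B (comp_cls f2, comp_cls g2).
  move=> Afg f2 g2; split; [exact: rep_L2|exact: rep_L2|].
  by exists f, g; split=> //; exact: rep_comp_cls.
have rdotE u v f g : L2 nu f -> L2 nu g ->
    rep u = (fun x => f (phi x)) %[ae mu] ->
    rep v = (fun x => g (phi x)) %[ae mu] -> rdot (u : L2H mu) v = fdot nu f g.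
  move=> f2 g2 uf vg; rewrite -fdot_comp//.
  by apply: l2dotE => //; exact: L2_comp.
have clB u : hclosure (odom B) u ->
    exists2 f, L2 nu f & rep u = (fun x => f (phi x)) %[ae mu].
  apply: closed_range_comp => w [w' [_ _ [f [g [/A2[f2 _] wf _]]]]].
  by exists f.
split.
- split.
    split; [exact: rep_L2|exact: rep_L2|].
    by exists (fun=> 0), (fun=> 0); split=> //; exact: rep0.
  move=> c u v u' v' [_ _ [f [g [fg uf vg]]]] [_ _ [f' [g' [fg' uf' vg']]]].
  split; [exact: rep_L2|exact: rep_L2|].
  exists (fun y => c * f y + f' y), (fun y => c * g y + g' y); split=> /=.
  + exact: AL.
  + move: uf uf' (repZ c u) (repD (c *: u) u').
    apply: filterS4 => x /(_ I) /= h1 /(_ I) /= h2 /(_ I) h3 /(_ I) h4 _.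
    by rewrite h4 h3 h1 h2.
  + move: vg vg' (repZ c v) (repD (c *: v) v').
    apply: filterS4 => x /(_ I) /= h1 /(_ I) /= h2 /(_ I) h3 /(_ I) h4 _.
    by rewrite h4 h3 h1 h2.
- move=> u v u' v' [_ _ [f [g [fg uf vg]]]] [_ _ [f' [g' [fg' uf' vg']]]].
  have [f2 g2] := A2 _ _ fg; have [f'2 g'2] := A2 _ _ fg'.
  rewrite (rdotE _ _ _ _ g2 f'2 vg uf') (rdotE _ _ _ _ f2 g'2 uf vg').
  move: fg'; rewrite Aadj => -[_ _ /(_ _ _ fg)].
  by rewrite !L2dotE => -[].
- move=> u v [_ _ [f [g [fg uf vg]]]] e e0; have [f2 g2] := A2 _ _ fg.
  have [|h [h' hh'] gh] := (Adense _ g2).2 (Num.sqrt e).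
    by rewrite sqrtr_gt0.
  have [h2 h'2] := A2 _ _ hh'.
  exists (comp_cls h2); first by exists (cls (L2_comp h'2)); exact: pullA.
  have -> : sqn (v - comp_cls h2) =
      fdot nu (fun y => g y - h y) (fun y => g y - h y).
    apply: rdotE; [exact: L2B|exact: L2B|..];
    move: vg (rep_comp_cls h2) (repB v (comp_cls h2));
      by apply: filterS3 => x /(_ I) /= h1 /(_ I) h2' /(_ I) h3 _;
        rewrite h3 h2' h1.
  rewrite -L2norm_sqr -[e]sqr_sqrtr ?(ltW e0)//.
  by rewrite ltr_sqr ?nnegrE ?L2norm_ge0 ?sqrtr_ge0.
move=> u w /clB[f f2 uf] /clB[h h2 wh] uw.
have fdotA a b : A (a, b) -> fdot nu b f = fdot nu a h.
  move=> ab; have [a2 b2] := A2 _ _ ab.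
  have := uw _ _ (pullA _ _ ab a2 b2).
  rewrite (rdotE _ _ _ _ b2 f2 (rep_comp_cls _) uf).
  by rewrite (rdotE _ _ _ _ a2 h2 (rep_comp_cls _) wh).
split; [exact: rep_L2|exact: rep_L2|exists f, h; split=> //].
(* [adjoint] asks for a complex identity. Its imaginary part is the real one tested on the multiple
   of [(a, b)] by [- 'i], which is again in [A]. *)
rewrite Aadj; split=> // a b ab; rewrite !L2dotE !fdot_iZr (fdotA _ _ ab).
congr (_ +i* _); apply: fdotA.
have := AL (- 'i) _ _ _ _ ab A0; congr (A (_, _)); apply/funext => y;
  exact: addr0.
Qed.

End MeasurePreserving.

Section SelfAdjoint.
Context {R : realType} {d : measure_display} {T : measurableType d}.
Variable mu : {measure set T -> \bar R}.
Implicit Types (A : @opgraph R d T).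

Lemma self_adjoint_saturated A : self_adjoint mu A -> opsaturated mu A.
Proof. by move=> [[A2 Asat _ _ _] _ _]; split. Qed.

Lemma hselfadjoint_lift A :
  self_adjoint mu A -> hselfadjoint (lift (mu := mu) A).
Proof.
move=> SA; have [A2 Asat] := self_adjoint_saturated SA.
(* The identity preserves the measure, so [hselfadjoint_pull] applies with [phi := id]. *)
have <- : pull mu id A = A.
  apply/seteqP; split=> -[u v].
    by move=> [/= u2 v2 [f [g [fg uf vg]]]]; apply: Asat fg u2 v2 _ _;
      apply: ae_eq_sym.
  move=> uv; have [u2 v2] := A2 _ _ uv; split=> //.
  by exists u, v; split=> //; exact: ae_eq_refl.
by apply: hselfadjoint_pull SA => // B mB; rewrite preimage_id.
Qed.

Lemma lift_dense A : self_adjoint mu A ->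
  forall u, hclosure (odom (lift (mu := mu) A)) u.
Proof.
move=> SA u; rewrite (odom_lift (self_adjoint_saturated SA)).
rewrite -liftset_L2closure; last exact/saturated_dom/self_adjoint_saturated.
by have [_ Adense _] := SA; apply: Adense; exact: rep_L2.
Qed.

Lemma L2dot_eq0P (S : set (T -> R[i])) f :
  (forall g, S g -> S (fun x => 'i * g x)) ->
  (forall g, S g -> L2dot mu f g = 0) <-> (forall g, S g -> fdot mu f g = 0).
Proof.
move=> Si; split=> fS g Sg; first by have := fS _ Sg; rewrite L2dotE => -[].
by rewrite L2dotE !fS//; exact: Si.
Qed.

End SelfAdjoint.

(** Radii of balls in [R[i]] are elements of [R[i]]; a positive one is real, so balls can be
    described by real squared radii. *)
Lemma closure_csq {R : realType} (S : set R[i]) (l : R[i]) :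
  closure S l <-> forall r : R, 0 < r -> exists2 z, S z & csq (z - l) < r.
Proof.
split=> [Sl r r0|Sl].
  have sr0 : 0 < (Num.sqrt r)%:C :> R[i] by rewrite ltcR sqrtr_gt0.
  have [z [Sz lz]] := Sl _ (nbhsx_ballx l _ sr0); exists z => //.
  have : `|l - z| < (Num.sqrt r)%:C by exact: lz.
  by rewrite distrC normc_def ltcR ltr_sqrt.
move=> B /nbhs_ballP[e e0 eB].
have [Re0 eE] : 0 < complex.Re e /\ e = (complex.Re e)%:C.
  have : (0 : R[i]) < e by exact: e0.
  rewrite ltcE /= => /andP[/eqP ime ?]; split=> //.
  by apply/eqP; rewrite eq_complex /= ime !eqxx.
have [|z Sz zl] := Sl (complex.Re e ^+ 2); first by rewrite exprn_gt0.
exists z; split=> //; apply: eB; suff : `|l - z| < e by [].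
rewrite distrC normc_def eE ltcR.
by rewrite -[ltRHS](gtr0_norm Re0) -sqrtr_sqr ltr_sqrt ?exprn_gt0.
Qed.

Lemma saturated_orthocompl {R : realType} {d : measure_display}
    {T : measurableType d} (mu : {measure set T -> \bar R})
    (S : set (T -> R[i])) : S `<=` L2 mu -> saturated mu (orthocompl mu S).
Proof.
move=> S2; split=> [f []//|f f' [f2 fS] f'2 ff']; split=> // g Sg.
have g2 := S2 _ Sg; rewrite -(fS _ Sg) !L2dotE.
congr (_ +i* _); apply: eq_ae_fdot => //; try exact: ae_eq_refl;
  by [apply: ae_eq_sym|exact: L2Z].
Qed.

(** * Pulled-back Laplacians and their orthogonal parts *)

Section ProjectiveLimit.
Context {R : realType} (F : projective_system R).
Variables (mun : forall n, {measure set (gpoint (qgraph F n)) -> \bar R}).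
Variables (mu : {measure set (plimit F) -> \bar R}).

Lemma measurable_coord n :
  measurable_fun setT (fun x : plimit F => Defs.coord x n).
Proof.
move=> _ B mB; rewrite setTI; apply: sub_sigma_algebra.
by exists n => //; exists B.
Qed.

Definition plift n : set (L2H mu * L2H mu) := lift (pullback mun mu n).

Lemma opsaturated_pullback n : opsaturated mu (pullback mun mu n).
Proof. exact: opsaturated_pull. Qed.

Lemma pdom_L2 n : pdom mun mu n `<=` L2 mu.
Proof. by move=> f [g []]. Qed.

Lemma saturated_orthodom n : saturated mu (orthodom mun mu n).
Proof.
have satp m : saturated mu (pdom mun mu m).
  exact/saturated_dom/opsaturated_pullback.
case: n => [|n]; first exact: satp.
have [_ so] := saturated_orthocompl (@pdom_L2 n).
have [_ sp] := satp n.+1.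
split=> [f [[]]//|f g [of_ pf] g2 fg].
by split; [exact: so of_ g2 fg|exact: sp pf g2 fg].
Qed.

Lemma orthodom_pdom n : orthodom mun mu n `<=` pdom mun mu n.
Proof. by case: n => [|n] f //= []. Qed.

Lemma opsaturated_orthopart n :
  opsaturated mu (Defs.restrict (pullback mun mu n) (orthodom mun mu n)).
Proof.
have [p2 sp] := opsaturated_pullback n; have [_ so] := saturated_orthodom n.
split=> [f g [/p2]//|f g f' g' [fg ofg] f'2 g'2 ff' gg'].
by split; [exact: sp fg f'2 g'2 ff' gg'|exact: so ofg f'2 ff'].
Qed.

Hypothesis mu_limit : limit_measure mun mu.
Hypothesis An_self_adjoint :
  forall n, self_adjoint (mun n) (graph_laplacian (mun n)).

Lemma hselfadjoint_plift n : hselfadjoint (plift n).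
Proof.
exact: (hselfadjoint_pull (@measurable_coord n) (@mu_limit n)
  (An_self_adjoint n)).
Qed.

Lemma pdom_iZ n f : pdom mun mu n f -> pdom mun mu n (fun x => 'i * f x).
Proof.
move=> pf; have f2 := pdom_L2 pf; have [Blin _ _ _] := hselfadjoint_plift n.
have [_ sp] := saturated_dom (opsaturated_pullback n).
have : liftset (pdom mun mu n) ('i *: (cls f2 : L2H mu)).
  rewrite -(odom_lift (opsaturated_pullback n)).
  apply: subspaceZ (subspace_odom Blin) _.
  rewrite (odom_lift (opsaturated_pullback n)); apply: liftset_cls => //.
  exact/saturated_dom/opsaturated_pullback.
move=> /sp; apply; first exact: L2Z.
have := repZ 'i (cls f2); have := rep_cls f2.
by apply: filterS2 => x /(_ I) h1 /(_ I) h2 _; rewrite h2 h1.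
Qed.

(** [orthocompl] is complex orthogonality, [rdot] only real; they agree here because [pdom] is
    stable under ['i]. *)
Lemma liftset_orthodomP n u : liftset (mu := mu) (orthodom mun mu n) u <->
  liftset (pdom mun mu n) u /\
  forall w, odom (prev_op plift n) w -> rdot u w = 0.
Proof.
case: n => [|n].
  split=> [pu|[]//]; split=> // w [w' [-> _]].
  exact: rdot0r.
rewrite [prev_op _ _]/= (odom_lift (opsaturated_pullback n)); split.
  move=> [[u2 uo] pu]; split=> // w pw.
  have := uo _ pw; rewrite L2dotE => -[uw _].
  exact: uw.
move=> [pu uo]; split=> //; split; first exact: rep_L2.
apply/(L2dot_eq0P _ _ (@pdom_iZ n)) => g pg; have g2 := pdom_L2 pg.
rewrite -(l2dotE (rep_L2 u) g2 (rep_refl u) (rep_cls g2)).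
apply: uo; apply: liftset_cls => //.
exact/saturated_dom/opsaturated_pullback.
Qed.

Lemma lift_orthopart n :
  lift (Defs.restrict (pullback mun mu n) (orthodom mun mu n)) =
  step_op plift n.
Proof.
apply/seteqP; split=> -[u v] [uv uo]; split=> //.
  by have /liftset_orthodomP[] := uo.
apply/liftset_orthodomP; split=> //.
by exists (rep v).
Qed.

Lemma liftset_orthodom n :
  liftset (orthodom mun mu n) = odom (step_op plift n).
Proof.
rewrite -lift_orthopart (odom_lift (opsaturated_orthopart n)).
congr liftset; apply/seteqP; split=> f.
  by move=> fo; have [g fg] := orthodom_pdom fo; exists g.
by move=> [g []].
Qed.

Lemma orthospectrumE n : orthospectrum mun mu n =
  ~` hresolvent (hclosure (odom (step_op plift n))) (step_op plift n).
Proof.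
rewrite /orthospectrum /spectrum resolvent_lift.
- by rewrite lift_orthopart liftset_L2closure ?liftset_orthodom//;
    exact: saturated_orthodom.
- have [so s_ae] := saturated_orthodom n; split=> [f []//|].
  move=> f g [f2 fS] g2 fg; split=> // e /fS[h oh fh]; exists h => //.
  have h2 := so _ oh; rewrite L2normE in fh; rewrite L2normE.
  rewrite (eq_ae_fdot (L2B g2 h2) (L2B g2 h2) (L2B f2 h2) (L2B f2 h2))//;
    by move: fg; apply: filterS => x /(_ I) fgx _; rewrite fgx.
- exact: opsaturated_orthopart.
Qed.

Lemma orthomultiplicityE n l : orthomultiplicity mun mu n l =
  hdim (heigenspace (step_op plift n) l).
Proof.
rewrite /orthomultiplicity (multiplicity_lift _ (opsaturated_orthopart n)).
by rewrite lift_orthopart.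
Qed.

End ProjectiveLimit.

Arguments plift {R F} mun mu n.
Arguments opsaturated_pullback {R F} mun mu n.

Theorem theorem3p1 (R : realType) (F : projective_system R)
  (mun : forall n, {measure set (gpoint (qgraph F n)) -> \bar R})
  (mu : {measure set (plimit F) -> \bar R})
  (mun_compatible : compatible_measures mun)
  (mu_limit : limit_measure mun mu)
  (An_self_adjoint : forall n, self_adjoint (mun n) (graph_laplacian (mun n)))
  (An_increasing : forall n, pullback mun mu n `<=` pullback mun mu n.+1)
  (A : opgraph (plimit F))
  (A_limit : is_projective_limit mun mu A) :
  spectrum mu (L2 mu) A = closure (\bigcup_n orthospectrum mun mu n) /\
  forall lambda : R[i],
    multiplicity mu A lambda =
      (\sum_(0 <= n <oo) orthomultiplicity mun mu n lambda)%E.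
Proof.
have [SA pA _ AE] := A_limit.
have SB := hselfadjoint_plift mu_limit An_self_adjoint.
have BS n : plift mun mu n `<=` plift mun mu n.+1.
  by move=> uv; exact: An_increasing.
have BA n : plift mun mu n `<=` lift A by move=> uv; exact: pA.
have SAl := hselfadjoint_lift SA.
have satA := self_adjoint_saturated SA.
(* The graph closure controls a sum of norms; taken with [Num.sqrt e], it bounds each squared norm
   by [e]. *)
have AB u v : lift (mu := mu) A (u, v) -> forall e : R, 0 < e ->
    exists n w z, [/\ plift mun mu n (w, z), sqn (u - w) < e & sqn (v - z) < e].
  rewrite /lift /= AE => -[u2 v2 uvA] e e0.
  have [|[f g] [n _ fg] uvfg] := uvA (Num.sqrt e); first by rewrite sqrtr_gt0.
  have [f2 g2] := (opsaturated_pullback mun mu n).1 _ _ fg.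
  have sqn_lt (x : L2H mu) h (h2 : L2 mu h) :
      L2norm mu (fun y => rep x y - h y) < Num.sqrt e -> sqn (x - cls h2) < e.
    rewrite /sqn [rdot _ _](l2dotB x h2 (rep_cls h2)) -L2norm_sqr => xh.
    by rewrite -[e]sqr_sqrtr ?(ltW e0)// ltr_sqr ?nnegrE ?L2norm_ge0 ?sqrtr_ge0.
  exists n, (cls f2), (cls g2); split.
  - exact: lift_cls (opsaturated_pullback mun mu n) fg.
  - by apply: sqn_lt; apply: le_lt_trans uvfg; rewrite lerDl L2norm_ge0.
  - by apply: sqn_lt; apply: le_lt_trans uvfg; rewrite lerDr L2norm_ge0.
split; last first.
  move=> l; rewrite (multiplicity_lift _ satA) (hdim_series SB BS SAl BA AB).
  congr (limn _); apply/funext => n; apply: eq_bigr => i _.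
  by rewrite orthomultiplicityE.
have satL2 : saturated mu (L2 mu) by split.
have liftL2 : liftset (mu := mu) (L2 mu) = setT.
  by apply/seteqP; split=> // u _; exact: rep_L2.
rewrite /spectrum (resolvent_lift satL2 satA) liftL2.
(* By [closure_csq], being outside the closure is exactly the condition of [resolvent_sum], with the
   same squared radius. *)
apply/seteqP; split=> l /=.
  move=> lA; apply: contrapT => lN; apply: lA.
  apply/(resolvent_sum SB BS SAl BA AB (lift_dense SA)).
  move: lN => /closure_csq/existsNP[r /not_implyP[r0 rN]].
  exists r => // n l' l'r; apply: contrapT => l'N; apply: rN.
  by exists l' => //; exists n => //; rewrite orthospectrumE.
move=> /closure_csq lcl /(resolvent_sum SB BS SAl BA AB (lift_dense SA)).
move=> [r r0 rS]; have [z [n _ +] zl] := lcl _ r0.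
by rewrite orthospectrumE => // zN; apply: zN; exact: rS.
Qed.
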